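(* Let $k$ be a field and let $H$ be a Hopf algebra over $k$ with bijective antipode. Let $N\ge 1$ and let $\pi_i : P\rightarrow P_i$, $i\in \{1,\ldots,N\}$, be surjections of right $H$-comodule algebras such that $\bigcap_{i=1}^N \ker\pi_i=0$. Then $P$ is principal if and only if all the $P_i$, $i=1,\ldots,N$, are principal.
   Context: All algebras, coalgebras, etc. are over a field $k$, and $\otimes=\otimes_k$. Let $(H,\Delta,\varepsilon,S)$ be a Hopf algebra with bijective antipode. A right $H$-comodule algebra $P$ is a unital associative algebra equipped with a right $H$-coaction $\Delta_P:P\to P\otimes H$, $p\mapsto p_{(0)}\otimes p_{(1)}$, that is an algebra map. A surjection of right $H$-comodule algebras is a surjective unital algebra homomorphism which is right $H$-colinear. The coaction-invariant subalgebra is $P^{\mathrm{co}H}:=\{p\in P\mid \Delta_P(p)=p\otimes 1\}$. With $B:=P^{\mathrm{co}H}$, the comodule algebra $P$ is called principal if: (1) the coaction is Galois, i.e. the canonical map $P\otimes_B P\to P\otimes H$, $p\otimes q\mapsto pq_{(0)}\otimes q_{(1)}$, is bijective; and (2) $P$ is right $H$-equivariantly projective as a left $B$-module, i.e. there exists a right $H$-colinear and left $B$-linear splitting $P\to B\otimes P$ of the multiplication map $B\otimes P\to P$ (where $H$ coacts on $B\otimes P$ via $\mathrm{id}_B\otimes\Delta_P$). *)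

(* Defs.v *)
From HB Require Import structures.
From mathcomp Require Import all_boot all_order all_algebra.
From mathcomp Require Import boolp.
From mathcomp.multinomials Require Import freeg.

Set Implicit Arguments.
Unset Strict Implicit.
Unset Printing Implicit Defensive.

Import GRing.Theory.
Local Open Scope ring_scope.
Local Open Scope quotient_scope.

Reserved Notation "u ⊗ v" (at level 40, left associativity).

Section SpanQuotient.
Variables (k : fieldType) (V : lmodType k) (G : V -> Prop).

(* The linear span of G; span_quot is V modulo this subspace. *)
Inductive spanned : V -> Prop :=
| spanned0 : spanned 0
| spannedPZ c g v : G g -> spanned v -> spanned (c *: g + v).

Definition in_span : {pred V} := fun v => `[< spanned v >].

Lemma in_spanP v : reflect (spanned v) (v \in in_span).
Proof. exact: asboolP. Qed.

Lemma in_span_gen g : G g -> g \in in_span.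
Proof.
move=> Gg; apply/in_spanP; rewrite -[g]addr0 -[g]scale1r.
by apply: spannedPZ => //; exact: spanned0.
Qed.

Lemma in_span_submod_closed : GRing.submod_closed in_span.
Proof.
split=> [|a u v /in_spanP su /in_spanP sv]; first by apply/in_spanP; constructor.
apply/in_spanP; elim: su => [|c g w Gg _ IH]; first by rewrite scaler0 add0r.
by rewrite scalerDr scalerA -addrA; constructor.
Qed.

HB.instance Definition _ :=
  GRing.isZmodClosed.Build V in_span (GRing.submod_closedB in_span_submod_closed).

Lemma in_spanZ c v : v \in in_span -> c *: v \in in_span.
Proof.
have [S0 SP] := in_span_submod_closed.
by move=> vS; rewrite -[_ *: _]addr0 SP.
Qed.

Definition span_quot : Type := Quotient.quot (in_span : zmodClosed V).

HB.instance Definition _ := GRing.Zmodule.on span_quot.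
HB.instance Definition _ := Quotient.on span_quot.

Definition qproj (v : V) : span_quot := \pi_(Quotient.quot (in_span : zmodClosed V)) v.
Definition qrepr (x : span_quot) : V := repr x.

Lemma qprojP x y : reflect (qproj x = qproj y) (x - y \in in_span).
Proof. by rewrite Quotient.idealrBE; exact: eqP. Qed.

Lemma qreprK : cancel qrepr qproj.
Proof. by move=> x; rewrite /qproj /qrepr reprK. Qed.

Lemma qrepr_qproj v : qrepr (qproj v) - v \in in_span.
Proof. by apply/qprojP; rewrite qreprK. Qed.

Definition qscale (c : k) (x : span_quot) : span_quot := qproj (c *: qrepr x).

Lemma qscale_qproj c v : qscale c (qproj v) = qproj (c *: v).
Proof. by apply/qprojP; rewrite -scalerBr; apply: in_spanZ (qrepr_qproj v). Qed.

Lemma qproj_is_zmod_morphism : zmod_morphism qproj.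
Proof. by move=> x y; rewrite /qproj !piE. Qed.

HB.instance Definition _ :=
  GRing.isZmodMorphism.Build V span_quot qproj qproj_is_zmod_morphism.

Fact qscaleA a b x : qscale a (qscale b x) = qscale (a * b) x.
Proof. by rewrite -[x]qreprK !qscale_qproj scalerA. Qed.
Fact qscale1 : left_id 1 qscale.
Proof. by move=> x; rewrite -[x]qreprK qscale_qproj scale1r. Qed.
Fact qscaleDr : right_distributive qscale +%R.
Proof.
move=> a x y; rewrite -[x]qreprK -[y]qreprK -raddfD !qscale_qproj.
by rewrite scalerDr raddfD.
Qed.
Fact qscaleDl x : {morph qscale^~ x : a b / a + b}.
Proof.
by move=> a b; rewrite -[x]qreprK !qscale_qproj scalerDl raddfD.
Qed.

HB.instance Definition _ := GRing.Zmodule_isLmodule.Build k span_quot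
  qscaleA qscale1 qscaleDr qscaleDl.

Fact qproj_is_scalable : scalable qproj.
Proof. by move=> a v; rewrite -qscale_qproj. Qed.

HB.instance Definition _ :=
  GRing.isScalable.Build k V span_quot *:%R qproj qproj_is_scalable.

Section Lift.
Variables (W : lmodType k) (f : V -> W).
Hypotheses (f_lin : linear f) (fG : forall g, G g -> f g = 0).

Let fB : {morph f : x y / x - y} := GRing.zmod_morphism_linear f_lin.

Let f0 : f 0 = 0. Proof. by rewrite -(subrr 0) fB subrr. Qed.

Lemma lin_in_span v : v \in in_span -> f v = 0.
Proof.
by move=> /in_spanP; elim=> // c g w /fG fg0 _ IH; rewrite f_lin fg0 IH scaler0 addr0.
Qed.

Lemma lin_qrepr v : f (qrepr (qproj v)) = f v.
Proof. by apply/eqP; rewrite -subr_eq0 -fB lin_in_span // qrepr_qproj. Qed.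

Lemma lin_qrepr_linear : linear (f \o qrepr).
Proof. by move=> a x y /=; rewrite -[x]qreprK -[y]qreprK -linearP !lin_qrepr f_lin. Qed.
End Lift.

End SpanQuotient.

Section Tensor.
Variables (k : fieldType) (U V : lmodType k).

Local Notation gen u v := (<< (u, v) >> : {freeg (U * V)%type / k}).

Variant tensor_rel : {freeg (U * V)%type / k} -> Prop :=
| TensorRelL c u u' v :
    tensor_rel (gen (c *: u + u') v - (c *: gen u v + gen u' v))
| TensorRelR c u v v' :
    tensor_rel (gen u (c *: v + v') - (c *: gen u v + gen u v')).

(* U ⊗ V: the free vector space on U * V modulo the bilinearity relations. *)
Definition tensor : Type := span_quot tensor_rel.

HB.instance Definition _ := GRing.Lmodule.on tensor.

Definition tens (u : U) (v : V) : tensor := qproj tensor_rel (gen u v).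


Lemma tensPl c u u' v : tens (c *: u + u') v = c *: tens u v + tens u' v.
Proof. by rewrite -linearP; apply/qprojP/in_span_gen; exact: TensorRelL. Qed.

Lemma tensPr c u v v' : tens u (c *: v + v') = c *: tens u v + tens u v'.
Proof. by rewrite -linearP; apply/qprojP/in_span_gen; exact: TensorRelR. Qed.

Lemma tens0l v : tens 0 v = 0.
Proof.
by apply: (addrI (tens 0 v)); rewrite -{1}[tens 0 v]scale1r -tensPl scaler0 !addr0.
Qed.

Lemma tensZl c u v : tens (c *: u) v = c *: tens u v.
Proof. by rewrite -[c *: u]addr0 tensPl tens0l addr0. Qed.

Lemma tens_ind (P : tensor -> Prop) :
  P 0 -> (forall u v t, P t -> P (tens u v + t)) -> forall t, P t.
Proof.
move=> P0 PS t; rewrite -[t]qreprK -[qrepr t]freeg_sumE raddf_sum /=.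
elim: (dom _) => [|[u v] s IH]; rewrite ?big_nil // big_cons.
set c := coeff _ _; suff -> : qproj tensor_rel << c *g (u, v) >> = tens (c *: u) v.
  exact: PS.
rewrite tensZl -linearZ /=; congr (qproj _ _).
apply/eqP/freeg_eqP => z.
by rewrite coeffZ !coeffU mul1r.
Qed.

End Tensor.

Arguments tensor {k} (U V)%_type_scope.
Notation "U ⊗ V" := (tensor U V) : type_scope.
Notation "u ⊗ v" := (tens u v) : ring_scope.

Definition bilin (k : fieldType) (U V W : lmodType k) (f : U -> V -> W) :=
  (forall v, linear (f^~ v)) /\ (forall u, linear (f u)).

Section TensorLift.
Variables (k : fieldType) (U V W : lmodType k).
Implicit Types f g : U -> V -> W.

(* For bilinear f this is the linear map induced by f (tliftE, tlift_linear).
   It is defined for every f, through a representative, so that no proof of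
   bilinearity appears in the definitions below; it is applied to bilinear f
   only. *)
Definition tlift f (t : U ⊗ V) : W := fglift (fun p => f p.1 p.2) (qrepr t).

Lemma fgliftE (K : choiceType) (h : K -> W) (D : {freeg K / k}) :
  fglift h D = \sum_(x <- repr D) x.1 *: h x.2.
Proof. by unlock fglift. Qed.

Lemma fglift_linear (K : choiceType) (h : K -> W) :
  linear (fglift h : {freeg K / k} -> W).
Proof.
pose F : {freeg K / k} -> W := fglift h.
pose FA := GRing.isZmodMorphism.Build _ _ F (@lift_is_additive k K W h).
pose F' : {additive {freeg K / k} -> W} := HB.pack F FA.
move=> c x y; rewrite -[fglift h]/(F' : _ -> _) raddfD; congr (_ + _).
rewrite -[x in RHS]freeg_sumE [c *: x]/(fgscale c x) /fgscale.
rewrite !raddf_sum.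
by apply: eq_bigr => z _; rewrite /= /F !liftU scalerA.
Qed.

Section Bilinear.
Variable f : U -> V -> W.
Hypothesis f_bilin : bilin f.

Let F := fglift (fun p : U * V => f p.1 p.2) : {freeg (U * V)%type / k} -> W.

Let F_lin : linear F. Proof. exact: fglift_linear. Qed.

Let F_rel r : tensor_rel r -> F r = 0.
Proof.
have FU u v : F << (u, v) >> = f u v by rewrite /F liftU scale1r.
have FB : {morph F : x y / x - y} := GRing.zmod_morphism_linear F_lin.
case=> [c u u' v|c u v v']; rewrite FB F_lin !FU.
  by rewrite (f_bilin.1 v) subrr.
by rewrite (f_bilin.2 u) subrr.
Qed.

Lemma tliftE u v : tlift f (u ⊗ v) = f u v.
Proof. by rewrite [LHS](lin_qrepr F_lin F_rel) /F liftU scale1r. Qed.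

Lemma tlift_linear : linear (tlift f).
Proof. exact: (lin_qrepr_linear F_lin F_rel). Qed.

End Bilinear.

Lemma tlift_linear_fun c f g h :
  (forall u v, h u v = c *: f u v + g u v) ->
  forall t, tlift h t = c *: tlift f t + tlift g t.
Proof.
move=> hE t; rewrite /tlift !fgliftE scaler_sumr -big_split /=.
by apply: eq_bigr => x _; rewrite hE scalerDr !scalerA mulrC.
Qed.

End TensorLift.

Lemma tens_bilin (k : fieldType) (U V : lmodType k) : bilin (@tens k U V).
Proof. by split=> [v c x y|u c x y]; rewrite (tensPl, tensPr). Qed.

Section TensorMap.
Variables (k : fieldType).

Definition tmap (U U' V V' : lmodType k) (f : U -> U') (g : V -> V') :
  U ⊗ V -> U' ⊗ V' := tlift (fun u v => f u ⊗ g v).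

Lemma tmap_bilin (U U' V V' : lmodType k) (f : U -> U') (g : V -> V') :
  linear f -> linear g -> bilin (fun u v => f u ⊗ g v).
Proof.
by move=> fl gl; split=> [v|u] c x y; rewrite (fl, gl) (tensPl, tensPr).
Qed.

Lemma tmapE (U U' V V' : lmodType k) (f : {linear U -> U'})
  (g : {linear V -> V'}) u v : tmap f g (u ⊗ v) = f u ⊗ g v.
Proof. by apply: tliftE; apply: tmap_bilin; exact: linearP. Qed.

Lemma tmap_linear (U U' V V' : lmodType k) (f : {linear U -> U'})
  (g : {linear V -> V'}) : linear (tmap f g).
Proof. by apply: tlift_linear; apply: tmap_bilin; exact: linearP. Qed.

HB.instance Definition _ (U U' V V' : lmodType k) (f : {linear U -> U'})
  (g : {linear V -> V'}) := GRing.isLinear.Build k _ _ _ (tmap f g) (tmap_linear f g).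

Definition tassoc (U V W : lmodType k) : U ⊗ (V ⊗ W) -> U ⊗ V ⊗ W :=
  tlift (fun u => tlift (fun v w => u ⊗ v ⊗ w)).

Lemma tassoc_bilin1 (U V W : lmodType k) (u : U) :
  bilin (fun (v : V) (w : W) => u ⊗ v ⊗ w).
Proof. by split=> [w|v] c x y; rewrite ?tensPr ?tensPl. Qed.

Lemma tassoc_bilin (U V W : lmodType k) :
  bilin (fun u : U => tlift (fun (v : V) (w : W) => u ⊗ v ⊗ w)).
Proof.
split=> [t c x y|u]; last exact: tlift_linear (tassoc_bilin1 V W u).
by apply: tlift_linear_fun => v w; rewrite !tensPl.
Qed.

Lemma tassocE (U V W : lmodType k) (u : U) (v : V) (w : W) :
  tassoc (u ⊗ (v ⊗ w)) = u ⊗ v ⊗ w.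
Proof. by rewrite [LHS](tliftE (@tassoc_bilin U V W)) (tliftE (tassoc_bilin1 V W u)). Qed.

Lemma tassoc_linear (U V W : lmodType k) : linear (@tassoc U V W).
Proof. exact: tlift_linear (@tassoc_bilin U V W). Qed.

HB.instance Definition _ (U V W : lmodType k) :=
  GRing.isLinear.Build k _ _ _ (@tassoc U V W) (@tassoc_linear U V W).

End TensorMap.

(* MathComp's algType requires 1 != 0; here the zero algebra is allowed. *)
Record algebra (k : fieldType) := Algebra {
  alg_lmod : lmodType k;
  alg_one : alg_lmod;
  alg_mul : alg_lmod -> alg_lmod -> alg_lmod;
  alg_mulA : associative alg_mul;
  alg_mul1l : left_id alg_one alg_mul;
  alg_mul1r : right_id alg_one alg_mul;
  alg_mul_bilin : bilin alg_mul
}.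

Definition alg_sort (k : fieldType) (A : algebra k) : Type := alg_lmod A.
Coercion alg_sort : algebra >-> Sortclass.

HB.instance Definition _ (k : fieldType) (A : algebra k) :=
  GRing.Lmodule.on (alg_sort A).
Coercion Defs_alg_sort__canonical__GRing_Lmodule : algebra >-> GRing.Lmodule.type.

Section AlgebraTheory.
Variables (k : fieldType) (A : algebra k).

Fact alg_mulDl : left_distributive (@alg_mul k A) +%R.
Proof.
move=> x y z; have := (alg_mul_bilin A).1 z 1 x y.
by rewrite !scale1r.
Qed.
Fact alg_mulDr : right_distributive (@alg_mul k A) +%R.
Proof.
move=> x y z; have := (alg_mul_bilin A).2 x 1 y z.
by rewrite !scale1r.
Qed.

HB.instance Definition _ := GRing.Zmodule_isPzRing.Build (alg_sort A)
  (@alg_mulA k A) (@alg_mul1l k A) (@alg_mul1r k A) alg_mulDl alg_mulDr.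

Lemma algmull_linear (a : A) : linear ( *%R a : A -> A).
Proof. exact: (alg_mul_bilin A).2. Qed.
Lemma algmulr_linear (a : A) : linear ( *%R^~ a : A -> A).
Proof. exact: (alg_mul_bilin A).1. Qed.

Lemma algscalerAl c (x y : A) : c *: (x * y) = (c *: x) * y.
Proof. by have := algmulr_linear y c x 0; rewrite mul0r !addr0. Qed.
Lemma algscalerAr c (x y : A) : c *: (x * y) = x * (c *: y).
Proof. by have := algmull_linear x c y 0; rewrite mulr0 !addr0. Qed.

Definition lmul (a x : A) : A := a * x.
HB.instance Definition _ (a : A) :=
  GRing.isLinear.Build k A A *:%R (lmul a) (algmull_linear a).
End AlgebraTheory.

Section TensorAlgebra.
Variables (k : fieldType) (A B : algebra k).

Definition tmul (x y : A ⊗ B) : A ⊗ B :=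
  tlift (fun (a : A) (b : B) => tmap (lmul a) (lmul b) y) x.

Lemma tmul_bilin y : bilin (fun (a : A) (b : B) => tmap (lmul a) (lmul b) y).
Proof.
split=> [b|a] c u v; apply: tlift_linear_fun => a' b' /=.
  by rewrite -tensPl; congr (_ ⊗ _); exact: algmulr_linear.
by rewrite -tensPr; congr (_ ⊗ _); exact: algmulr_linear.
Qed.

Lemma tmul_tens a b a' b' : tmul (a ⊗ b) (a' ⊗ b') = (a * a') ⊗ (b * b').
Proof. by rewrite /tmul (tliftE (tmul_bilin _)) tmapE. Qed.

Lemma tmulPl c x x' y : tmul (c *: x + x') y = c *: tmul x y + tmul x' y.
Proof. exact: tlift_linear (tmul_bilin y) _ _ _. Qed.

Lemma tmulPr c x y y' : tmul x (c *: y + y') = c *: tmul x y + tmul x y'.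
Proof. by apply: tlift_linear_fun => a b; rewrite linearP. Qed.

Fact tmulDl : left_distributive tmul +%R.
Proof. by move=> x y z; have := tmulPl 1 x y z; rewrite !scale1r. Qed.
Fact tmulDr : right_distributive tmul +%R.
Proof. by move=> x y z; have := tmulPr 1 x y z; rewrite !scale1r. Qed.
Fact tmul0l y : tmul 0 y = 0.
Proof. by apply: (addrI (tmul 0 y)); rewrite -tmulDl !addr0. Qed.
Fact tmul0r y : tmul y 0 = 0.
Proof. by apply: (addrI (tmul y 0)); rewrite -tmulDr !addr0. Qed.

Fact tmulA : associative tmul.
Proof.
elim/tens_ind=> [y z|a b x IHx y z]; first by rewrite !tmul0l.
rewrite !tmulDl IHx; congr (_ + _).
elim/tens_ind: y z => [z|a' b' y IHy z]; first by rewrite tmul0l !tmul0r tmul0l.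
rewrite !(tmulDl, tmulDr) IHy; congr (_ + _).
elim/tens_ind: z {y IHy} => [|a'' b'' z IHz]; first by rewrite !tmul0r.
by rewrite !tmulDr IHz !tmul_tens !mulrA.
Qed.
Fact tmul1l : left_id ((1 : A) ⊗ (1 : B)) tmul.
Proof.
elim/tens_ind=> [|a b x IHx]; first by rewrite tmul0r.
by rewrite tmulDr IHx tmul_tens !mul1r.
Qed.
Fact tmul1r : right_id ((1 : A) ⊗ (1 : B)) tmul.
Proof.
elim/tens_ind=> [|a b x IHx]; first by rewrite tmul0l.
by rewrite tmulDl IHx tmul_tens !mulr1.
Qed.

HB.instance Definition _ := GRing.Zmodule_isPzRing.Build (A ⊗ B)%type
  tmulA tmul1l tmul1r tmulDl tmulDr.

Lemma tensM (a a' : A) (b b' : B) : (a ⊗ b) * (a' ⊗ b') = (a * a') ⊗ (b * b').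
Proof. exact: tmul_tens. Qed.

Lemma tens1 : (1 : A) ⊗ (1 : B) = 1. Proof. by []. Qed.

End TensorAlgebra.

Record hopfAlgebra (k : fieldType) := HopfAlgebra {
  hopf_alg :> algebra k;
  comul : {linear hopf_alg -> (hopf_alg ⊗ hopf_alg)%type};
  counit : {linear hopf_alg -> k^o};
  antipode : {linear hopf_alg -> hopf_alg};
  comulA : forall h, tmap comul idfun (comul h) = tassoc (tmap idfun comul (comul h));
  counitl : forall h, tlift (fun a b => counit a *: b) (comul h) = h;
  counitr : forall h, tlift (fun a b => counit b *: a) (comul h) = h;
  comul_monoid : monoid_morphism comul;
  counit_monoid : monoid_morphism counit;
  antipodel : forall h, tlift (fun a b : hopf_alg => (antipode a : hopf_alg) * b) (comul h)
    = counit h *: (1 : hopf_alg);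
  antipoder : forall h, tlift (fun a b : hopf_alg => a * (antipode b : hopf_alg)) (comul h)
    = counit h *: (1 : hopf_alg)
}.

Section ComoduleAlgebra.
Variables (k : fieldType) (H : hopfAlgebra k).

Record comodAlgebra := ComodAlgebra {
  comod_alg :> algebra k;
  coact : {linear comod_alg -> (comod_alg ⊗ H)%type};
  coactA : forall p,
    tmap coact idfun (coact p) = tassoc (tmap idfun (comul H) (coact p));
  coact_counit : forall p,
    tlift (fun q h => counit H h *: q) (coact p) = p;
  coact_monoid : monoid_morphism coact
}.

Definition colinear (V W : lmodType k) (rV : V -> V ⊗ H) (rW : W -> W ⊗ H)
    (f : V -> W) : Prop :=
  forall v, rW (f v) = tmap f idfun (rV v).

Definition comodalg_surjection (P Q : comodAlgebra) (f : {linear P -> Q}) : Prop :=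
  [/\ monoid_morphism f, colinear (coact P) (coact Q) f &
      forall q, exists p, f p = q].

Variable P : comodAlgebra.

Definition coinvariant : {pred P} := fun p => coact P p == p ⊗ (1 : H).

Fact coinvariant_submod_closed : GRing.submod_closed coinvariant.
Proof.
split=> [|c x y]; rewrite !unfold_in /=.
  by rewrite linear0 tens0l.
by move=> /eqP px /eqP py; rewrite linearP px py tensPl.
Qed.

Fact coinvariant_subring_closed : subring_closed coinvariant.
Proof.
have [_ BB] := GRing.submod_closedB coinvariant_submod_closed.
split=> //; first by rewrite unfold_in /= (coact_monoid P).1.
move=> x y; rewrite !unfold_in /= => /eqP px /eqP py.
by rewrite (coact_monoid P).2 px py tensM mulr1.
Qed.

Definition coinv_type : Type := {p : P | p \in coinvariant}.
HB.instance Definition _ := SubChoice.on coinv_type.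
HB.instance Definition _ := GRing.SubChoice_isSubLmodule.Build k P coinvariant
  coinv_type (GRing.submod_closed_semi coinvariant_submod_closed).
HB.instance Definition _ := GRing.SubZmodule_isSubPzRing.Build P coinvariant
  coinv_type coinvariant_subring_closed.

Fact coinv_mul_bilin :
  bilin ( *%R : coinv_type -> coinv_type -> coinv_type).
Proof.
split=> [b|b] c x y; apply: val_inj; first exact: algmulr_linear.
exact: algmull_linear.
Qed.

Definition coinv : algebra k :=
  @Algebra k coinv_type 1 *%R (@mulrA _) (@mul1r _) (@mulr1 _) coinv_mul_bilin.

Definition coinv_val (b : coinv) : P := sval b.

Fact coinv_val_linear : linear coinv_val.
Proof. by []. Qed.
HB.instance Definition _ :=
  GRing.isLinear.Build k coinv P *:%R coinv_val coinv_val_linear.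

Lemma coinv_valM : {morph coinv_val : b c / b * c}.
Proof. by []. Qed.

Lemma coinv_val_coact (b : coinv) : coact P (coinv_val b) = coinv_val b ⊗ (1 : H).
Proof. by case: b => p /= /eqP. Qed.

(* P ⊗_B P for B = coinv, as P ⊗_k P modulo pb ⊗ q - p ⊗ bq. *)
Variant btensor_rel : (P ⊗ P)%type -> Prop :=
| BTensorRel (p q : P) (b : coinv) :
    btensor_rel ((p * coinv_val b) ⊗ q - p ⊗ (coinv_val b * q)).

Definition btensor : Type := span_quot btensor_rel.
HB.instance Definition _ := GRing.Lmodule.on btensor.

Definition btens (p q : P) : btensor := qproj btensor_rel (p ⊗ q).

Definition canon_k : P ⊗ P -> P ⊗ H :=
  tlift (fun p q : P => tmap (lmul p) idfun (coact P q)).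

(* p ⊗_B q |-> p q_(0) ⊗ q_(1), see canonE; independent of the representative
   by canon_k_rel. *)
Definition canon (x : btensor) : (P ⊗ H)%type := canon_k (qrepr x).

Lemma canon_k_bilin : bilin (fun p q : P => tmap (lmul p) idfun (coact P q)).
Proof.
split=> [q|p] c x y; last by rewrite !linearP.
by apply: tlift_linear_fun => p h; rewrite -tensPl; congr (_ ⊗ _); exact: algmulr_linear.
Qed.

Lemma tmap_lmul (p : P) (t : (P ⊗ H)%type) : tmap (lmul p) idfun t = (p ⊗ (1 : H)) * t.
Proof.
elim/tens_ind: t => [|q h t IH]; first by rewrite linear0 mulr0.
rewrite linearD mulrDr; congr (_ + _); last exact: IH.
by rewrite [LHS]tmapE tensM mul1r.
Qed.

Lemma canon_k_rel t : btensor_rel t -> canon_k t = 0.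
Proof.
have cB : {morph canon_k : x y / x - y} :=
  GRing.zmod_morphism_linear (tlift_linear canon_k_bilin).
case=> p q b; rewrite cB /canon_k !(tliftE canon_k_bilin) !tmap_lmul.
by rewrite (coact_monoid P).2 coinv_val_coact mulrA tensM mulr1 subrr.
Qed.

Lemma canonE p q : canon (btens p q) = tmap (lmul p) idfun (coact P q).
Proof.
rewrite [LHS](lin_qrepr (tlift_linear canon_k_bilin) canon_k_rel).
exact: (tliftE canon_k_bilin).
Qed.

Lemma canon_linear : linear canon.
Proof. exact: (lin_qrepr_linear (tlift_linear canon_k_bilin) canon_k_rel). Qed.

(* id_B ⊗ Δ_P, with B ⊗ (P ⊗ H) identified with (B ⊗ P) ⊗ H. *)
Definition coinv_tens_coact (t : (coinv ⊗ P)%type) : (coinv ⊗ P ⊗ H)%type :=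
  tassoc (tmap idfun (coact P) t).

Definition coinv_tens_mul : coinv ⊗ P -> P :=
  tlift (fun (b : coinv) (p : P) => coinv_val b * p).

Lemma coinv_tens_mulE b p : coinv_tens_mul (b ⊗ p) = coinv_val b * p.
Proof.
rewrite [LHS]tliftE //; split=> [q|a] c x y; last exact: algmull_linear.
by rewrite linearP; exact: algmulr_linear.
Qed.

Definition galois : Prop := bijective canon.

(* The action b (b' ⊗ p) = bb' ⊗ p of B on B ⊗ P is tmap (lmul b) idfun. *)
Definition equivariantly_projective : Prop :=
  exists s : {linear P -> (coinv ⊗ P)%type},
    [/\ colinear (coact P) coinv_tens_coact s,
        forall (b : coinv) (p : P), s (coinv_val b * p) = tmap (lmul b) idfun (s p) &
        forall p, coinv_tens_mul (s p) = p].

Definition principal : Prop := galois /\ equivariantly_projective.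

End ComoduleAlgebra.

(* Main.v *)
(** Idea. Call a linear map l : H -> P ⊗ P, h |-> h<1> ⊗ h<2>, that is colinear
    on both sides and satisfies h<1> h<2> = counit h a strong connection.
    P is principal iff it has one: from the inverse of the canonical map and an
    equivariant splitting s one takes l h = s applied to the second leg of
    canon^-1 (1 ⊗ h); conversely p ⊗ h |-> p h<1> ⊗_B h<2> inverts the canonical
    map and p |-> p_0 p_1<1> ⊗ p_1<2> takes values in B ⊗ P and splits the
    multiplication.  Strong connections can be pushed forward along the pi_i.

    Conversely, let l_i be a strong connection on P_i.  If F : P_i -> B_i is a
    linear projection then j_i h = F(h<1>) h<2> is a unital colinear map
    H -> P_i, and averaging
      g v = f(v_0)_0 J(S(f(v_0)_1) v_1),   J a unital linear lift of j_i,
    turns a linear f : V -> P into a map g with pi_i \o g colinear, without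
    changing pi_j \o f whenever the latter is colinear.  Starting from a linear
    section of pi_i and averaging for every index gives, as the kernels meet in
    0, a colinear section a_i of pi_i.  Then L_i = (a_i ⊗ a_i) \o l_i is
    bicolinear, its defect c_i = counit - mult \o L_i takes values in ker pi_i,
    and L_1 + c_1 * L_2 (convolution) is bicolinear with defect c_1 * c_2.
    Iterating, the defect lies in every kernel, hence vanishes. *)

Require Import Defs.
From HB Require Import structures.
From mathcomp Require Import all_boot all_order all_algebra.
From mathcomp Require Import boolp classical_sets.

Set Implicit Arguments.
Unset Strict Implicit.
Unset Printing Implicit Defensive.

Import GRing.Theory.
Local Open Scope ring_scope.

Definition linear_of (k : fieldType) (U V : lmodType k) (f : U -> V)
    (f_lin : linear f) : {linear U -> V} :=
  HB.pack f (GRing.isLinear.Build k U V *:%R f f_lin).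

(** * Linear complements *)

(** Zorn's lemma on the sets closed under [c *: u + v] that meet [S] in at most 0. A maximal one is
    a complement, since a vector outside [A + S] could be adjoined. *)
Lemma complement_exists (k : fieldType) (V : lmodType k) (S : V -> Prop) :
  S 0 -> (forall c u v, S u -> S v -> S (c *: u + v)) ->
  exists C : V -> Prop,
    [/\ C 0, forall c u v, C u -> C v -> C (c *: u + v),
        forall v, C v -> S v -> v = 0 &
        forall v, exists2 c, C c & S (v - c)].
Proof.
move=> S0 SP.
(* Membership of 0 is left out of [good], so that the union of the empty chain is good; [A0]
   recovers it from maximality. *)
pose good (A : set V) := (forall c u v, A u -> A v -> A (c *: u + v)) /\
  (forall v, A v -> S v -> v = 0).
have [|A [[AP AS] Amax]] := @Zorn_bigcup V good.
  move=> F FG tot; split=> [c u v [X FX Xu] [Y FY Yv]|v [X FX Xv]].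
    have [XY|YX] := tot _ _ FX FY.
      by exists Y => //; have [YP _] := FG _ FY; apply: YP => //; apply: XY.
    by exists X => //; have [XP _] := FG _ FX; apply: XP => //; apply: YX.
  by have [_] := FG _ FX; apply.
have Aext (B : set V) v : good B -> (A `<=` B)%classic -> B v -> A v.
  move=> gB AB Bv; apply: contrapT => nAv; apply: (Amax _ _ gB); split => //.
  by move=> BA; apply/nAv/BA.
have A0 : A 0.
  apply: (@Aext [set w : V | w = 0 \/ A w]%classic); last by left.
    split=> [c u v [->|Au] [->|Av]|v [->|]] //; last exact: AS.
    - by left; rewrite scaler0 addr0.
    - by right; rewrite scaler0 add0r.
    (* With 0 not yet known to lie in [A], [c *: u] is written as [(c - 1) *: u + u]. *)
    - right; rewrite addr0 -[c](subrK 1) addrC scalerDl scale1r addrC.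
      exact: AP.
    - by right; exact: AP.
  by right.
exists A; split=> // v.
have [SA|nSA] := pselect (exists2 a, A a & S (v - a)); first by case: SA => a; exists a.
have Av : A v; last by exists v; rewrite ?subrr.
apply: (@Aext [set w : V | exists c, exists2 x, A x & w = c *: v + x]%classic).
- split=> [c _ _ [d [x Ax ->]] [e [y Ay ->]]|w [c [x Ax ->]] Sw].
    exists (c * d + e), (c *: x + y); first exact: AP.
    by rewrite scalerDl scalerDr scalerA addrACA.
  have [c0|c0] := eqVneq c 0.
    by move: Sw; rewrite c0 scale0r add0r; exact: AS.
  case: nSA; exists (- c^-1 *: x); first by rewrite -[_ *: _]addr0; exact: AP.
  have := SP c^-1 _ _ Sw S0.
  by rewrite addr0 scalerDr scalerA mulVf // scale1r scaleNr opprK.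
- by move=> a Aa; exists 0, a => //; rewrite scale0r add0r.
- by exists 1, 0 => //; rewrite scale1r addr0.
Qed.

(** The component of [v] in a complement of [S] is unique, hence linear in [v]; subtracting it
    projects onto [S]. *)
Lemma projection_exists (k : fieldType) (V : lmodType k) (S : V -> Prop) :
  S 0 -> (forall c u v, S u -> S v -> S (c *: u + v)) ->
  exists e : {linear V -> V}, (forall v, S (e v)) /\ (forall v, S v -> e v = v).
Proof.
move=> S0 SP; have [C [C0 CP CS Cex]] := complement_exists S0 SP.
have SZ c v : S v -> S (c *: v) by move=> Sv; rewrite -[_ *: _]addr0; exact: SP.
have SB u v : S u -> S v -> S (u - v).
  by move=> Su Sv; rewrite -scaleN1r addrC; exact: SP.
have CB u v : C u -> C v -> C (u - v).
  by move=> Su Sv; rewrite -scaleN1r addrC; exact: CP.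
have /choice[c cP] v : exists c, C c /\ S (v - c) by have [c] := Cex v; exists c.
have cE v w : C w -> S (v - w) -> c v = w.
  move=> Cw Sw; have [Cv Sv] := cP v; apply/eqP; rewrite -subr_eq0; apply/eqP.
  apply: CS; first exact: CB.
  by have := SB _ _ Sw Sv; rewrite opprB addrC addrA subrK.
have c_lin : linear c.
  move=> a u v; apply: cE; first by apply: CP; [have [] := cP u|have [] := cP v].
  rewrite opprD addrACA -scalerBr; apply: SP.
    by have [] := cP u.
  by have [] := cP v.
pose cL := linear_of c_lin.
exists (idfun \- cL) => /=; split=> v; first by have [] := cP v.
by move=> Sv; rewrite /= (cE _ 0) ?subr0.
Qed.

(** Preimages under [D] of the projection of [w] to the image are chosen without linearity; removing
    the component along the kernel makes the result independent of the choice, hence linear. *)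
Lemma pseudo_inverse_exists (k : fieldType) (V W : lmodType k) (D : {linear V -> W}) :
  exists g : {linear W -> V}, forall v, D (g (D v)) = D v.
Proof.
have [e [eK ke]] : exists e : {linear V -> V},
    (forall v, D (e v) = 0) /\ (forall v, D v = 0 -> e v = v).
  by apply: projection_exists => [|c u v Du Dv]; rewrite ?linear0 // linearP Du Dv scaler0 addr0.
have [|c _ _ [v ->] [w ->]|f [fI If]] := @projection_exists k W (fun w => exists v, w = D v).
- by exists 0; rewrite linear0.
- by exists (c *: v + w); rewrite linearP.
have /choice[h hP] := fI.
pose g w := h w - e (h w).
have Dg w : D (g w) = f w by rewrite linearB eK subr0 -hP.
have gE w v : D v = f w -> g w = v - e v.
  move=> Dv; have /ke : D (h w - v) = 0 by rewrite linearB -hP Dv subrr.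
  rewrite linearB => eE; apply/eqP.
  by rewrite subr_eq addrAC -addrA eE addrC subrK.
have g_lin : linear g.
  move=> a u v; rewrite (gE _ (a *: h u + h v)); last by rewrite !linearP -!hP.
  by rewrite linearP opprD addrACA -scalerBr.
exists (linear_of g_lin) => v /=.
by rewrite Dg If //; exists v.
Qed.

(** * Multilinear maps and sums over tensors *)

Section LinearClosure.
Variables (k : fieldType) (T : lmodType k).

Lemma linear_idfun : linear (fun x : T => x). Proof. by []. Qed.

Lemma linear_comp (U V : lmodType k) (g : {linear U -> V}) (f : T -> U) :
  linear f -> linear (fun x => g (f x)).
Proof. by move=> fl c x y; rewrite fl linearP. Qed.

Lemma linear_addf (U : lmodType k) (f g : T -> U) :
  linear f -> linear g -> linear (fun x => f x + g x).
Proof. by move=> fl gl c x y; rewrite fl gl scalerDr addrACA. Qed.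

Lemma linear_oppf (U : lmodType k) (f : T -> U) :
  linear f -> linear (fun x => - f x).
Proof. by move=> fl c x y; rewrite fl opprD scalerN. Qed.

Lemma linear_tensl (U V : lmodType k) (f : T -> U) (v : V) :
  linear f -> linear (fun x => f x ⊗ v).
Proof. by move=> fl c x y; rewrite fl tensPl. Qed.

Lemma linear_tensr (U V : lmodType k) (f : T -> V) (u : U) :
  linear f -> linear (fun x => u ⊗ f x).
Proof. by move=> fl c x y; rewrite fl tensPr. Qed.

Lemma linear_mulr (A : algebra k) (f : T -> A) (a : A) :
  linear f -> linear (fun x => f x * a).
Proof. by move=> fl c x y; rewrite fl mulrDl algscalerAl. Qed.

Lemma linear_mull (A : algebra k) (f : T -> A) (a : A) :
  linear f -> linear (fun x => a * f x).
Proof. by move=> fl c x y; rewrite fl mulrDr algscalerAr. Qed.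

Lemma linear_tmulr (A B : algebra k) (f : T -> (A ⊗ B)%type) (t : (A ⊗ B)%type) :
  linear f -> linear (fun x => f x * t).
Proof. by move=> fl c x y; rewrite fl; exact: tmulPl. Qed.

Lemma linear_tmull (A B : algebra k) (f : T -> (A ⊗ B)%type) (t : (A ⊗ B)%type) :
  linear f -> linear (fun x => t * f x).
Proof. by move=> fl c x y; rewrite fl; exact: tmulPr. Qed.

Lemma linear_scalel (U : lmodType k) (f : T -> k^o) (u : U) :
  linear f -> linear (fun x => f x *: u).
Proof. by move=> fl c x y; rewrite fl scalerDl scalerA. Qed.

Lemma linear_scaler (U : lmodType k) (f : T -> U) (a : k) :
  linear f -> linear (fun x => a *: f x).
Proof. by move=> fl c x y; rewrite fl scalerDr !scalerA mulrC. Qed.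

Lemma linear_tliftl (U V W : lmodType k) (F : T -> U -> V -> W) t :
  (forall u v, linear (fun x => F x u v)) -> linear (fun x => tlift (F x) t).
Proof. by move=> Fl c x y; apply: tlift_linear_fun => u v; exact: Fl. Qed.

Lemma linear_tliftr (U V W : lmodType k) (F : U -> V -> W) (f : T -> U ⊗ V) :
  bilin F -> linear f -> linear (fun x => tlift F (f x)).
Proof. by move=> Fb fl c x y; rewrite fl (tlift_linear Fb). Qed.

Lemma linear_app13 (U X : lmodType k) (V W : Type) (F : U -> V -> W -> X) (f : T -> U) v w :
  linear (fun u => F u v w) -> linear f -> linear (fun x => F (f x) v w).
Proof. by move=> Fl fl c x y; rewrite fl Fl. Qed.

Lemma linear_app23 (V X : lmodType k) (U W : Type) (F : U -> V -> W -> X) (f : T -> V) u w :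
  linear (fun v => F u v w) -> linear f -> linear (fun x => F u (f x) w).
Proof. by move=> Fl fl c x y; rewrite fl Fl. Qed.

Lemma linear_app33 (W X : lmodType k) (U V : Type) (F : U -> V -> W -> X) (f : T -> W) u v :
  linear (F u v) -> linear f -> linear (fun x => F u v (f x)).
Proof. by move=> Fl fl c x y; rewrite fl Fl. Qed.

Lemma linear_app12 (U X : lmodType k) (V : Type) (F : U -> V -> X) (f : T -> U) v :
  linear (fun u => F u v) -> linear f -> linear (fun x => F (f x) v).
Proof. by move=> Fl fl c x y; rewrite fl Fl. Qed.

Lemma linear_app22 (V X : lmodType k) (U : Type) (F : U -> V -> X) (f : T -> V) u :
  linear (F u) -> linear f -> linear (fun x => F u (f x)).
Proof. by move=> Fl fl c x y; rewrite fl Fl. Qed.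

Lemma linear_app11 (U X : lmodType k) (F : U -> X) (f : T -> U) :
  linear F -> linear f -> linear (fun x => F (f x)).
Proof. by move=> Fl fl c x y; rewrite fl Fl. Qed.

Lemma bilinI (U V : lmodType k) (F : T -> U -> V) :
  (forall u, linear (fun x => F x u)) -> (forall x, linear (F x)) -> bilin F.
Proof. by []. Qed.

End LinearClosure.

Ltac eta_linear :=
  lazymatch goal with
  | |- @GRing.linear_for _ _ _ _ (fun x => _) => idtac
  | |- @GRing.linear_for ?R ?U ?V ?s ?f => change (@GRing.linear_for R U V s (fun x => f x))
  | |- _ => idtac
  end.

(** Descends through the body of a function to its variable. Linearity of a function variable [F] in
    each argument is taken from the context, which is why proofs split trilinearity into [F1], [F2],
    [F3]; [linear_app23] refers to the second of three arguments. *)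
Ltac multilin := cbv beta; eta_linear;
  lazymatch goal with
  | |- bilin _ => apply: bilinI => ?; multilin
  | |- _ (fun x => x) => exact: linear_idfun
  | |- _ (fun x => tens _ _) =>
    first [apply: linear_tensl; multilin | apply: linear_tensr; multilin]
  | |- _ (fun x => tlift _ _) => first
    [ apply: linear_tliftl => ? ?; multilin | apply: linear_tliftr; multilin ]
  | |- _ (fun x => _ *: _) => first
    [ apply: linear_scalel; multilin | apply: linear_scaler; multilin ]
  | |- _ (fun x => _ + _) => apply: linear_addf; multilin
  | |- _ (fun x => - _) => apply: linear_oppf; multilin
  | |- _ (fun x => _ * _) => first
    [ apply: linear_mulr; multilin | apply: linear_mull; multilin
    | apply: linear_tmulr; multilin | apply: linear_tmull; multilin ]
  | |- _ => first
    [ solve [auto]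
    | exact: linearP
    | match goal with
      | |- _ (fun x => ?F (@?f x) ?v ?w) => is_var F; apply: (@linear_app13 _ _ _ _ _ _ F f)
      | |- _ (fun x => ?F ?v (@?f x) ?w) => is_var F; apply: (@linear_app23 _ _ _ _ _ _ F f)
      | |- _ (fun x => ?F ?v ?w (@?f x)) => is_var F; apply: (@linear_app33 _ _ _ _ _ _ F f)
      | |- _ (fun x => ?F (@?f x) ?v) => is_var F; apply: (@linear_app12 _ _ _ _ _ F f)
      | |- _ (fun x => ?F ?v (@?f x)) => is_var F; apply: (@linear_app22 _ _ _ _ _ F f)
      | |- _ (fun x => ?F (@?f x)) => is_var F; apply: (@linear_app11 _ _ _ _ F f)
      end; multilin
    | apply: linear_comp; multilin ]
  end.

Section Sweedler.
Variable k : fieldType.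
Implicit Types U V W X Y : lmodType k.

Lemma eq_tlift U V W (F G : U -> V -> W) t :
  (forall u v, F u v = G u v) -> tlift F t = tlift G t.
Proof. by move=> FG; congr (tlift _ t); apply/funext => u; apply/funext => v. Qed.

Lemma linear_tlift U V W X (g : {linear W -> X}) (F : U -> V -> W) t :
  g (tlift F t) = tlift (fun u v => g (F u v)) t.
Proof.
rewrite /tlift !fgliftE raddf_sum; apply: eq_bigr => x _. exact: linearZZ.
Qed.

Lemma linearZW U V (g : U -> V) c u : linear g -> g (c *: u) = c *: g u.
Proof. by move=> gl; rewrite -[g]/(linear_of gl : _ -> _) linearZ. Qed.

Lemma linear_tliftW U V W X (g : W -> X) (F : U -> V -> W) t :
  linear g -> g (tlift F t) = tlift (fun u v => g (F u v)) t.
Proof. by move=> gl; rewrite -[g]/(linear_of gl : _ -> _) linear_tlift. Qed.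

Lemma tlift_map0 U V W (t : (U ⊗ V)%type) :
  tlift (fun (u : U) (v : V) => (0 : W)) t = 0.
Proof. by have /= <- := linear_tlift (\0 : {linear W -> W}) (fun _ _ => 0) t. Qed.

Lemma tlift_mapD U V W (F G : U -> V -> W) (t : (U ⊗ V)%type) :
  tlift (fun u v => F u v + G u v) t = tlift F t + tlift G t.
Proof.
rewrite -[tlift F t]scale1r; apply: tlift_linear_fun => u v.
by rewrite scale1r.
Qed.

(** Both sides are the same double sum over representatives of [t] and [t'], taken in the two
    orders. *)
Lemma tlift_exchange U V W X Y (F : U -> V -> W -> X -> Y) t t' :
  tlift (fun u v => tlift (F u v) t') t =
  tlift (fun w x => tlift (fun u v => F u v w x) t) t'.
Proof.
rewrite /tlift !fgliftE.
under eq_bigr do rewrite fgliftE scaler_sumr.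
rewrite exchange_big; apply: eq_bigr => x _; rewrite fgliftE scaler_sumr.
by apply: eq_bigr => y _; rewrite !scalerA mulrC.
Qed.

Lemma tlift0 U V W (F : U -> V -> W) : bilin F -> tlift F 0 = 0.
Proof. by move=> Fb; have := linear0 (linear_of (tlift_linear Fb)). Qed.

Lemma tliftD U V W (F : U -> V -> W) t t' :
  bilin F -> tlift F (t + t') = tlift F t + tlift F t'.
Proof. by move=> Fb; have := linearD (linear_of (tlift_linear Fb)) t t'. Qed.

Lemma eq_linear_tens U V W (f g : U ⊗ V -> W) : linear f -> linear g ->
  (forall u v, f (u ⊗ v) = g (u ⊗ v)) -> f =1 g.
Proof.
move=> fl gl fg; elim/tens_ind=> [|u v t IH].
  by have := linear0 (linear_of fl); have := linear0 (linear_of gl) => /= -> ->.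
rewrite -[_ + t](scale1r (_ + t)) scalerDr scale1r -[u ⊗ v](scale1r (u ⊗ v)).
by rewrite fl gl fg !scale1r IH.
Qed.

Lemma tlift_tens U V t : tlift (@tens k U V) t = t.
Proof.
apply: (@eq_linear_tens U V _ (tlift (@tens k U V)) idfun) => //.
  exact: tlift_linear (tens_bilin _ _).
by move=> u v; rewrite tliftE //; exact: tens_bilin.
Qed.

Lemma tlift_tlift U V W X Y (F : W -> X -> Y) (G : U -> V -> W ⊗ X) t :
  bilin F -> tlift F (tlift G t) = tlift (fun u v => tlift F (G u v)) t.
Proof. by move=> Fb; rewrite -[tlift F]/(linear_of (tlift_linear Fb) : _ -> _) linear_tlift. Qed.

Lemma tlift_tmap U V U' V' W (F : U' -> V' -> W) (f : {linear U -> U'})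
  (g : {linear V -> V'}) t :
  bilin F -> tlift F (tmap f g t) = tlift (fun u v => F (f u) (g v)) t.
Proof.
move=> Fb; rewrite {1}/tmap tlift_tlift //; apply: eq_tlift => u v.
by rewrite tliftE.
Qed.

End Sweedler.

Section Trilinear.
Variable k : fieldType.
Implicit Types U V W X : lmodType k.

Definition trilinear U V W X (F : U -> V -> W -> X) :=
  [/\ forall v w, linear (fun u => F u v w),
      forall u w, linear (fun v => F u v w) &
      forall u v, linear (F u v)].

Definition tlift3 U V W X (F : U -> V -> W -> X) : U ⊗ V ⊗ W -> X :=
  tlift (fun x w => tlift (fun u v => F u v w) x).

(** Turns identities stated with [tassoc], such as coassociativity, into a regrouping of nested
    sums. *)
Lemma tlift3_tassoc U V W X (F : U -> V -> W -> X) t : trilinear F ->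
  tlift3 F (tassoc t) = tlift (fun u x => tlift (F u) x) t.
Proof.
case=> F1 F2 F3; rewrite /tlift3 /tassoc.
rewrite tlift_tlift; last by multilin.
apply: eq_tlift => u x; rewrite tlift_tlift; last by multilin.
apply: eq_tlift => v w; rewrite tliftE; last by multilin.
by rewrite tliftE //; multilin.
Qed.
End Trilinear.

Ltac trilin := split=> ? ?; multilin.

(** * Comodule algebras in Sweedler notation *)

Reserved Notation "\tsum_ ( a , b <- t ) E"
  (at level 41, a at level 0, b at level 0, t at level 100, E at level 41,
   format "'[' \tsum_ ( a ,  b  <-  t ) '/  '  E ']'").
Reserved Notation "\tsum_ ( a : A , b : B <- t ) E"
  (at level 41, a at level 0, b at level 0, A at level 100, B at level 100,
   t at level 100, E at level 41).
Notation "\tsum_ ( a , b <- t ) E" := (tlift (fun a b => E) t) : ring_scope.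
Notation "\tsum_ ( a : A , b : B <- t ) E" :=
  (tlift (fun (a : A) (b : B) => E) t) (only parsing) : ring_scope.

Lemma tliftM (k : fieldType) (A B : algebra k) (W : lmodType k) (F : A -> B -> W)
    (s t : (A ⊗ B)%type) :
  bilin F -> tlift F (s * t) =
    \tsum_(a : A, b : B <- s) \tsum_(c : A, d : B <- t) F (a * c) (b * d).
Proof.
move=> Fb; rewrite [s * t]/(tmul s t) /tmul tlift_tlift //.
apply: eq_tlift => a b.
by rewrite (tlift_tmap (lmul a) (lmul b)).
Qed.

Section Coalgebra.
Variables (k : fieldType) (H : hopfAlgebra k).
Implicit Types (W : lmodType k) (h : H).

Lemma comulA_sum W (F : H -> H -> H -> W) h : trilinear F ->
  \tsum_(x, c <- comul H h) \tsum_(a, b <- comul H x) F a b c =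
  \tsum_(a, y <- comul H h) \tsum_(b, c <- comul H y) F a b c.
Proof.
move=> Ft; have [F1 F2 F3] := Ft; have := congr1 (tlift3 F) (comulA h).
rewrite tlift3_tassoc // /tlift3.
by rewrite !tlift_tmap //=; multilin.
Qed.

Lemma counitl_sum W (F : {linear H -> W}) h :
  \tsum_(a, b <- comul H h) (counit H a *: F b) = F h.
Proof.
rewrite -{2}(counitl h) linear_tlift; apply: eq_tlift => a b.
by rewrite linearZ.
Qed.

Lemma counitr_sum W (F : {linear H -> W}) h :
  \tsum_(a, b <- comul H h) (counit H b *: F a) = F h.
Proof.
rewrite -{2}(counitr h) linear_tlift; apply: eq_tlift => a b.
by rewrite linearZ.
Qed.

Section Comodule.
Variable P : comodAlgebra H.

Lemma coactA_sum W (F : P -> H -> H -> W) p : trilinear F ->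
  \tsum_(x, h <- coact P p) \tsum_(y, g <- coact P x) F y g h =
  \tsum_(y, w <- coact P p) \tsum_(g, h <- comul H w) F y g h.
Proof.
move=> Ft; have [F1 F2 F3] := Ft; have := congr1 (tlift3 F) (coactA p).
rewrite tlift3_tassoc // /tlift3.
by rewrite !tlift_tmap //=; multilin.
Qed.

Lemma coact_counit_sum W (F : {linear P -> W}) p :
  \tsum_(a, b <- coact P p) (counit H b *: F a) = F p.
Proof.
rewrite -{2}(coact_counit p) linear_tlift; apply: eq_tlift => a b.
by rewrite linearZ.
Qed.

Lemma coactM_sum W (F : P -> H -> W) p q : bilin F ->
  tlift F (coact P (p * q)) =
  \tsum_(p0 : P, p1 : H <- coact P p)
    \tsum_(q0 : P, q1 : H <- coact P q) F (p0 * q0) (p1 * q1).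
Proof. by move=> Fb; rewrite (coact_monoid P).2 tliftM. Qed.

End Comodule.
End Coalgebra.

(** * Strong connections *)

Section Connection.
Variables (k : fieldType) (H : hopfAlgebra k).

Section OneAlgebra.
Variable P : comodAlgebra H.
Implicit Types (l : {linear H -> (P ⊗ P)%type}).

(* Identities in triple tensor products are stated after applying an arbitrary
   trilinear map F, so that they can be used under further multilinear maps. *)
Definition right_colinear_conn l := forall (W : lmodType k) (F : P -> P -> H -> W) h,
  trilinear F ->
  \tsum_(a : P, b : P <- l h) \tsum_(b0, b1 <- coact P b) F a b0 b1 =
  \tsum_(h1 : H, h2 : H <- comul H h) \tsum_(a, b <- l h1) F a b h2.

(* Left colinearity for p |-> S^-1(p_1) ⊗ p_0, written without the antipode. *)
Definition left_colinear_conn l := forall (W : lmodType k) (F : P -> H -> P -> W) h,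
  trilinear F ->
  \tsum_(h1 : H, h2 : H <- comul H h) \tsum_(a : P, b : P <- l h2)
    \tsum_(a0 : P, a1 : H <- coact P a) F a0 (h1 * a1) b =
  \tsum_(a : P, b : P <- l h) F a 1 b.

Definition bicolinear l := right_colinear_conn l /\ left_colinear_conn l.

Definition conn_mul l (h : H) : P := \tsum_(a : P, b : P <- l h) (a * b).

Definition strong_connection l :=
  bicolinear l /\ forall h, conn_mul l h = counit H h *: (1 : P).

(** The first leg is annihilated by a |-> a_0 ⊗ a_1 - a ⊗ 1; over a field this means that [t] lies
    in B ⊗ P. *)
Definition left_coinvariant (t : (P ⊗ P)%type) :=
  forall (W : lmodType k) (F : P -> H -> P -> W), trilinear F ->
  \tsum_(a : P, b : P <- t) \tsum_(a0, a1 <- coact P a) F a0 a1 b =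
  \tsum_(a : P, b : P <- t) F a 1 b.

Definition conn_split l (p : P) : (P ⊗ P)%type :=
  \tsum_(p0 : P, p1 : H <- coact P p) \tsum_(a : P, b : P <- l p1) ((p0 * a) ⊗ b).

Lemma conn_split_linear l : linear (conn_split l).
Proof. by rewrite /conn_split; multilin. Qed.

Lemma conn_splitE l (W : lmodType k) (F : P -> P -> W) p : bilin F ->
  tlift F (conn_split l p) =
  \tsum_(p0 : P, p1 : H <- coact P p) \tsum_(a : P, b : P <- l p1) F (p0 * a) b.
Proof.
move=> Fb; have [F1 F2] := Fb; rewrite /conn_split tlift_tlift //.
apply: eq_tlift => p0 p1; rewrite tlift_tlift //.
by apply: eq_tlift => a b; rewrite tliftE.
Qed.

(** The coaction on p_0 h<1>, with h = p_2, is p_0 h<1>_0 ⊗ p_1 h<1>_1, and left colinearity of [l]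
    cancels p_1 against h<1>_1. *)
Lemma conn_split_coinvariant l p :
  left_colinear_conn l -> left_coinvariant (conn_split l p).
Proof.
move=> ll W F Ft; have [F1 F2 F3] := Ft.
rewrite !conn_splitE; [|by multilin|by multilin].
under eq_tlift => p0 p1.
  under eq_tlift => a b.
    rewrite coactM_sum; last by multilin.
    over.
  rewrite tlift_exchange.
  over.
rewrite (@coactA_sum _ _ P _ (fun q0 q1 h => \tsum_(a : P, b : P <- l h)
  \tsum_(a0 : P, a1 : H <- coact P a) F (q0 * a0) (q1 * a1) b)); last by trilin.
apply: eq_tlift => p0 w.
rewrite (ll _ (fun x y z => F (p0 * x) y z)) //.
by trilin.
Qed.

(** Take e = id - g D, where D a = a_0 ⊗ a_1 - a ⊗ 1 and D g D = D. For left coinvariant [t] the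
    term g D vanishes on the first leg, so [t] can be treated as an element of B ⊗ P. *)
Lemma coinv_retraction : exists e : {linear P -> coinv P},
  (forall b, e (coinv_val b) = b) /\
  forall (W : lmodType k) (F : P -> P -> W) t, bilin F -> left_coinvariant t ->
    \tsum_(a : P, b : P <- t) F (coinv_val (e a)) b = tlift F t.
Proof.
pose D0 (a : P) : (P ⊗ H)%type := coact P a - a ⊗ (1 : H).
have D_lin : linear D0 by rewrite /D0; multilin.
pose D := linear_of D_lin.
have [g gP] := pseudo_inverse_exists D.
have eB a : (a - g (D a) : P) \in coinvariant (P:=P).
  have : D (a - g (D a)) = 0 by rewrite linearB gP subrr.
  by move=> /eqP; rewrite subr_eq0.
pose e0 a : coinv P := Sub (a - g (D a)) (eB a).
have e_lin : linear e0.
  move=> c x y; apply: val_inj => /=.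
  by rewrite D_lin (linearP g) opprD addrACA -scalerBr.
exists (linear_of e_lin); split=> [b|W F t Fb tco].
  apply: val_inj; rewrite /= /D0.
  by rewrite [coact P _]coinv_val_coact subrr linear0 subr0.
have [F1 F2] := Fb.
rewrite (@tlift_linear_fun _ _ _ _ (-1) (fun a b => F (g (D a)) b) F); last first.
  by move=> a b; rewrite -F1 scaleN1r addrC.
rewrite (@tlift_linear_fun _ _ _ _ (-1) (fun a b => F (g (a ⊗ (1 : H))) b)
  (fun a b => \tsum_(a0 : P, a1 : H <- coact P a) F (g (a0 ⊗ a1)) b)); last first.
  move=> a b; have gl : linear (fun x => F (g x) b) by multilin.
  by rewrite -(linear_tliftW _ _ gl) tlift_tens -gl scaleN1r addrC.
rewrite (tco _ (fun x y z => F (g (x ⊗ y)) z)); last by trilin.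
by rewrite !scaleN1r addNr oppr0 add0r.
Qed.

Lemma conn_split_mul l p : strong_connection l ->
  \tsum_(a : P, b : P <- conn_split l p) (a * b) = p.
Proof.
move=> [_ lm]; rewrite conn_splitE; last by multilin.
rewrite -[RHS](coact_counit_sum (idfun : {linear P -> P})); apply: eq_tlift => p0 p1 /=.
under eq_tlift do rewrite -mulrA.
rewrite -(linear_tliftW _ _ (algmull_linear p0)).
by rewrite -[tlift _ _]/(conn_mul l p1) lm -algscalerAr mulr1.
Qed.

Lemma strong_connection_galois l : strong_connection l -> galois P.
Proof.
move=> lS; have [[lr ll] lm] := lS.
have [e [_ eP]] := coinv_retraction.
pose Bt (p q : P) : span_quot (@btensor_rel k H P) := qproj (@btensor_rel k H P) (p ⊗ q).
have Bt1 q : linear (Bt^~ q) by rewrite /Bt; multilin.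
have Bt2 p : linear (Bt p) by rewrite /Bt; multilin.
pose K0 (p : P) (h : H) := \tsum_(a : P, b : P <- l h) Bt (p * a) b.
have K0b : bilin K0 by rewrite /K0; multilin.
exists (tlift K0).
  move=> x; suff : (fun t => tlift K0 (Defs.canon (qproj (@btensor_rel k H P) t))) =1
      qproj (@btensor_rel k H P) by rewrite -[x]qreprK; exact.
  have qL := tlift_linear K0b.
  apply: eq_linear_tens.
  - by move=> c u v; rewrite linearP (canon_linear c) qL.
  - by move=> c u v; rewrite linearP.
  move=> p q; rewrite -[qproj _ _]/(btens p q) canonE.
  rewrite (tlift_tmap (lmul p) idfun) //= /K0.
  transitivity (\tsum_(a : P, b : P <- conn_split l q) Bt (p * a) b).
    rewrite conn_splitE; last by multilin.
    by apply: eq_tlift => q0 q1; apply: eq_tlift => a b; rewrite mulrA.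
  have sc := @conn_split_coinvariant l q ll.
  rewrite -(eP _ (fun x y => Bt (p * x) y)) //; last by multilin.
  (* The first leg, now in B, crosses the balanced tensor sign, after which [conn_split] multiplies
     back to [q]. *)
  transitivity (\tsum_(a : P, b : P <- conn_split l q) Bt p (coinv_val (e a) * b)).
    by apply: eq_tlift => a b; apply/qprojP/in_span_gen; exact: BTensorRel.
  rewrite (eP _ (fun x y => Bt p (x * y))) //; last by multilin.
  by rewrite -(linear_tliftW _ _ (Bt2 p)) conn_split_mul.
suff E : (fun t => Defs.canon (tlift K0 t)) =1 idfun by move=> t; exact: E.
have KL := tlift_linear K0b.
apply: eq_linear_tens => // [c u v|p h].
  by rewrite KL (canon_linear c).
rewrite tliftE // /K0 (linear_tliftW _ _ (@canon_linear k H P)).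
transitivity (\tsum_(a : P, b : P <- l h) \tsum_(b0, b1 <- coact P b) ((p * a * b0) ⊗ b1)).
  by apply: eq_tlift => a b; rewrite canonE.
(* Right colinearity replaces the coaction on [b] by a comultiplication of [h]; the product of the
   two legs then collapses to a counit. *)
rewrite (lr _ (fun a b0 b1 => (p * a * b0) ⊗ b1)); last by trilin.
rewrite -[RHS](counitl_sum (linear_of ((tens_bilin P H).2 p))).
apply: eq_tlift => h1 h2.
have pL : linear (fun x : P => (p * x) ⊗ h2) by multilin.
under eq_tlift do rewrite -mulrA.
rewrite -(linear_tliftW _ _ pL) -[tlift _ _]/(conn_mul l h1) lm.
by rewrite -algscalerAr mulr1 tensZl.
Qed.

Lemma strong_connection_equivariantly_projective l :
  strong_connection l -> equivariantly_projective P.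
Proof.
move=> lS; have [[lr ll] lm] := lS.
have [e [eK eP]] := coinv_retraction.
pose S (p : P) : (coinv P ⊗ P)%type :=
  \tsum_(a : P, b : P <- conn_split l p) (e a ⊗ b).
have S_lin : linear S.
  by move=> c x y; rewrite /S conn_split_linear tlift_linear //; multilin.
have sc p := @conn_split_coinvariant l p ll.
exists (linear_of S_lin); split=> [p|b p|p] /=.
- rewrite /coinv_tens_coact /S.
  transitivity (\tsum_(a : P, b : P <- conn_split l p)
    \tsum_(b0, b1 <- coact P b) (e a ⊗ b0 ⊗ b1)).
    rewrite /tmap linear_tlift tlift_tlift; last by multilin.
    apply: eq_tlift => a b; rewrite tliftE; last by multilin.
    rewrite -{1}(tlift_tens (coact P b)) (linear_tliftW _ _ ((tens_bilin _ _).2 (e a))).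
    by rewrite linear_tlift; apply: eq_tlift => x y; exact: tassocE.
  rewrite conn_splitE; last by multilin.
  transitivity (\tsum_(y : P, w : H <- coact P p) \tsum_(g : H, h : H <- comul H w)
     \tsum_(a : P, b : P <- l g) (e (y * a) ⊗ b ⊗ h)).
    apply: eq_tlift => p0 p1.
    by rewrite (lr _ (fun a b0 b1 => e (p0 * a) ⊗ b0 ⊗ b1)) //; trilin.
  rewrite -coactA_sum; last by trilin.
  rewrite /tmap; apply: eq_tlift => x h /=.
  have hL : linear (fun t : (coinv P ⊗ P)%type => t ⊗ h) by multilin.
  rewrite conn_splitE; last by multilin.
  rewrite (linear_tliftW _ _ hL); apply: eq_tlift => y g.
  by rewrite (linear_tliftW _ _ hL).
- transitivity (\tsum_(a : P, b' : P <- conn_split l p) (e (coinv_val b * a) ⊗ b')).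
    rewrite /S conn_splitE; last by multilin.
    rewrite conn_splitE; last by multilin.
    rewrite coactM_sum; last by multilin.
    rewrite coinv_val_coact tliftE; last by multilin.
    by under eq_tlift do [under eq_tlift do rewrite -mulrA]; under eq_tlift do rewrite mul1r.
  rewrite -(eP _ (fun x y => e (coinv_val b * x) ⊗ y)) //; last by multilin.
  rewrite /S /tmap tlift_tlift; last by multilin.
  apply: eq_tlift => x y; rewrite tliftE; last by multilin.
  by rewrite -coinv_valM eK.
- rewrite /S.
  have mL : linear (@coinv_tens_mul k H P).
    by apply: tlift_linear; split=> [q|a] c x y;
      rewrite ?linearP; [exact: algmulr_linear|exact: algmull_linear].
  rewrite (linear_tliftW _ _ mL).
  under eq_tlift do rewrite coinv_tens_mulE.
  by rewrite (eP _ (fun x y => x * y)) ?conn_split_mul //; multilin.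
Qed.

Lemma strong_connection_principal l : strong_connection l -> principal P.
Proof.
by move=> lS; split; [exact: strong_connection_galois lS |
  exact: strong_connection_equivariantly_projective lS].
Qed.

End OneAlgebra.
End Connection.

(** * Cancelling the antipode in iterated sums *)

Section Antipode.
Variables (k : fieldType) (H : hopfAlgebra k).

Lemma antipoder_sum (W : lmodType k) (K : H -> H -> W) h : bilin K ->
  \tsum_(h1 : H, h2 : H <- comul H h) \tsum_(g1 : H, g2 : H <- comul H h2)
    K (h1 * (antipode H g1 : H)) g2 = K 1 h.
Proof.
move=> Kb; have [K1 K2] := Kb.
rewrite -(comulA_sum (F := fun a b c => K (a * (antipode H b : H)) c)); last by trilin.
rewrite -[RHS](counitl_sum (linear_of (K2 1))); apply: eq_tlift => x c /=.
rewrite -(linear_tliftW _ _ (K1 c)) antipoder.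
exact: (linearZW _ _ (K1 c)).
Qed.

(** Serves to insert or delete p_1 S(p_2) between p_0 and p_3 under further multilinear maps. *)
Lemma coact_antipode_sum (P : comodAlgebra H) (W : lmodType k)
    (K : P -> H -> H -> W) (p : P) : trilinear K ->
  \tsum_(p0 : P, p1 : H <- coact P p) \tsum_(y : P, g : H <- coact P p0)
    \tsum_(h1 : H, h2 : H <- comul H p1) K y (g * (antipode H h1 : H)) h2 =
  \tsum_(p0 : P, p1 : H <- coact P p) K p0 1 p1.
Proof.
move=> Kt; have [K1 K2 K3] := Kt.
rewrite (coactA_sum (F := fun y g w => \tsum_(h1 : H, h2 : H <- comul H w)
  K y (g * (antipode H h1 : H)) h2)); last by trilin.
by apply: eq_tlift => y z; rewrite (antipoder_sum (K := K y)) //; multilin.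
Qed.

End Antipode.

(** * From principality to a strong connection *)

Section PrincipalConnection.
Variables (k : fieldType) (H : hopfAlgebra k) (P : comodAlgebra H).
Variable s : {linear P -> (coinv P ⊗ P)%type}.
Hypothesis s_colin : colinear (coact P) (@coinv_tens_coact k H P) s.
Hypothesis s_lin : forall (b : coinv P) (p : P),
  s (coinv_val b * p) = tmap (lmul b) idfun (s p).
Hypothesis s_mul : forall p, coinv_tens_mul (s p) = p.

Lemma split_colinear_sum (W : lmodType k) (F : coinv P -> P -> H -> W) p : trilinear F ->
  \tsum_(c : coinv P, x : P <- s p) \tsum_(x0 : P, x1 : H <- coact P x) F c x0 x1 =
  \tsum_(p0 : P, p1 : H <- coact P p) \tsum_(c : coinv P, x : P <- s p0) F c x p1.
Proof.
move=> Ft; have [F1 F2 F3] := Ft; have := congr1 (tlift3 F) (s_colin p).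
rewrite tlift3_tassoc // /tlift3 !tlift_tmap //; last 2 first.
- by multilin.
- by multilin.
Qed.

(** The map p ⊗ q |-> p s(q), the coinvariant leg of s(q) being multiplied into p. By B-linearity of
    [s] it factors through P ⊗_B P as [Sig]. *)
Let sig (p q : P) : (P ⊗ P)%type :=
  \tsum_(c : coinv P, x : P <- s q) ((p * coinv_val c) ⊗ x).

Let sig_bilin : bilin sig. Proof. by rewrite /sig; multilin. Qed.

Let sig_rel t : btensor_rel t -> tlift sig t = 0.
Proof.
case=> p q b.
have sB := GRing.zmod_morphism_linear (tlift_linear sig_bilin).
rewrite sB !tliftE // /sig s_lin tlift_tmap; last by multilin.
apply/eqP; rewrite subr_eq0; apply/eqP; apply: eq_tlift => c x.
by rewrite -mulrA.
Qed.

Let Sig (x : span_quot (@btensor_rel k H P)) := tlift sig (qrepr x).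

Let SigE t : Sig (qproj (@btensor_rel k H P) t) = tlift sig t.
Proof. exact: (lin_qrepr (tlift_linear sig_bilin) sig_rel). Qed.

Let Sig_linear : linear Sig.
Proof. exact: (lin_qrepr_linear (tlift_linear sig_bilin) sig_rel). Qed.

Lemma canon_qproj t : Defs.canon (qproj (@btensor_rel k H P) t) =
  \tsum_(a : P, b : P <- t) \tsum_(b0 : P, b1 : H <- coact P b) ((a * b0) ⊗ b1).
Proof. exact: (lin_qrepr (tlift_linear (@canon_k_bilin k H P)) (@canon_k_rel k H P)). Qed.

Variable canon_inv : P ⊗ H -> span_quot (@btensor_rel k H P).
Hypothesis canonK : cancel (@Defs.canon k H P) canon_inv.
Hypothesis canon_invK : cancel canon_inv (@Defs.canon k H P).

Let canon_inv_linear : linear canon_inv.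
Proof.
move=> c x y; apply: (can_inj canonK).
by rewrite canon_linear !canon_invK.
Qed.

Let conn_linear : linear (fun h : H => Sig (canon_inv ((1 : P) ⊗ h))).
Proof. by multilin. Qed.

Definition principal_conn := linear_of conn_linear.
Local Notation l := principal_conn.

(** [t] is a representative in P ⊗ P of the translation map canon^-1 (1 ⊗ h), so that a b_0 ⊗ b_1
    summed over [t] is 1 ⊗ h. *)
Lemma translation_exists h : exists t : (P ⊗ P)%type,
  l h = tlift sig t /\
  forall (W : lmodType k) (G : P -> H -> W), bilin G ->
    \tsum_(a : P, b : P <- t) \tsum_(b0 : P, b1 : H <- coact P b) G (a * b0) b1 = G 1 h.
Proof.
pose t := qrepr (canon_inv ((1 : P) ⊗ h)).
have qt : qproj (@btensor_rel k H P) t = canon_inv ((1 : P) ⊗ h) by exact: qreprK.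
exists t; split; first by rewrite -SigE qt.
move=> W G Gb; have [G1 G2] := Gb.
rewrite -[RHS](tliftE Gb) -[(1 : P) ⊗ h]canon_invK -qt canon_qproj.
rewrite tlift_tlift //; apply: eq_tlift => a b.
rewrite tlift_tlift //; apply: eq_tlift => b0 b1.
by rewrite tliftE.
Qed.

(** By left P-linearity of the canonical map, p times a representative of canon^-1 (1 ⊗ h)
    represents canon^-1 (p ⊗ h). *)
Let Sig_canon_inv p h : Sig (canon_inv (p ⊗ h)) =
  \tsum_(u : P, v : P <- l h) ((p * u) ⊗ v).
Proof.
have [t [-> tP]] := translation_exists h.
pose t' := \tsum_(a : P, b : P <- t) ((p * a) ⊗ b).
have -> : p ⊗ h = Defs.canon (qproj (@btensor_rel k H P) t').
  rewrite canon_qproj /t' tlift_tlift; last by multilin.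
  have Gb : bilin (fun (x : P) (y : H) => (p * x) ⊗ y) by multilin.
  rewrite -[p]mulr1 -(tP _ _ Gb); apply: eq_tlift => a b.
  rewrite tliftE; last by multilin.
  by apply: eq_tlift => b0 b1; rewrite mulr1 mulrA.
rewrite canonK SigE /t' !tlift_tlift //; last by multilin.
apply: eq_tlift => a b; rewrite tliftE // /sig tlift_tlift; last by multilin.
apply: eq_tlift => c x; rewrite tliftE; last by multilin.
by rewrite mulrA.
Qed.

(** Recovers [s] from [l]: the canonical map sends 1 ⊗_B p to p_0 ⊗ p_1, and [Sig] of the inverse
    image of p_0 ⊗ p_1 is p_0 l(p_1). *)
Lemma principal_conn_split p (W : lmodType k) (F : P -> P -> W) : bilin F ->
  \tsum_(c : coinv P, x : P <- s p) F (coinv_val c) x = tlift F (conn_split l p).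
Proof.
move=> Fb; have [F1 F2] := Fb.
have -> : conn_split l p = sig 1 p.
  have -> : sig 1 p = Sig (qproj (@btensor_rel k H P) ((1 : P) ⊗ p)).
    by rewrite SigE tliftE.
  rewrite -[qproj _ _]canonK canon_qproj tliftE; last by multilin.
  have SL : linear (fun t => Sig (canon_inv t)) by multilin.
  rewrite (linear_tliftW _ _ SL); apply: eq_tlift => p0 p1.
  by rewrite mul1r Sig_canon_inv.
rewrite /sig tlift_tlift //; apply: eq_tlift => c x.
by rewrite tliftE // mul1r.
Qed.

(** Since [s] splits the multiplication, the product of the legs of [l h] is ab summed over the
    translation element, that is a b_0 counit(b_1), the value of id ⊗ counit at 1 ⊗ h. *)
Lemma principal_conn_mul h : conn_mul l h = counit H h *: (1 : P).
Proof.
have [t [lt tP]] := translation_exists h; rewrite /conn_mul lt.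
rewrite tlift_tlift; last by multilin.
rewrite -(tP (P : lmodType k) (fun x y => counit H y *: x)); last by multilin.
apply: eq_tlift => a b; rewrite /sig tlift_tlift; last by multilin.
transitivity (\tsum_(c : coinv P, x : P <- s b) (a * (coinv_val c * x))).
  by apply: eq_tlift => c x; rewrite tliftE ?mulrA //; multilin.
rewrite -(linear_tliftW _ _ (algmull_linear a)).
rewrite -[tlift _ _]/(coinv_tens_mul (s b)) s_mul.
rewrite -{1}(coact_counit b) (linear_tliftW _ _ (algmull_linear a)).
by apply: eq_tlift => b0 b1; exact: esym (algscalerAr _ _ _).
Qed.

(** Colinearity of [s] and [principal_conn_split] express the left side through a b_0 ⊗ b_1 summed
    over the translation element, which is 1 ⊗ h. *)
Lemma principal_conn_right : right_colinear_conn l.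
Proof.
move=> W F h Ft; have [F1 F2 F3] := Ft; have [t [lt tP]] := translation_exists h.
rewrite {1}lt tlift_tlift; last by multilin.
transitivity (\tsum_(a : P, b : P <- t) \tsum_(y : P, z : H <- coact P b)
  \tsum_(w : H, b1 : H <- comul H z) \tsum_(u : P, v : P <- l w) F (a * y * u) v b1).
  apply: eq_tlift => a b; rewrite /sig tlift_tlift; last by multilin.
  transitivity (\tsum_(c : coinv P, x : P <- s b) \tsum_(x0 : P, x1 : H <- coact P x)
     F (a * coinv_val c) x0 x1).
    by apply: eq_tlift => c x; rewrite tliftE //; multilin.
  rewrite (@split_colinear_sum _ (fun c x0 x1 => F (a * coinv_val c) x0 x1)); last by trilin.
  rewrite -(coactA_sum (F := fun y w b1 => \tsum_(u : P, v : P <- l w) F (a * y * u) v b1));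
    last by trilin.
  apply: eq_tlift => b0 b1.
  rewrite (@principal_conn_split _ _ (fun u v => F (a * u) v b1)); last by multilin.
  rewrite conn_splitE; last by multilin.
  by apply: eq_tlift => y w; apply: eq_tlift => u v; rewrite mulrA.
rewrite (tP _ (fun x z => \tsum_(w : H, b1 : H <- comul H z)
  \tsum_(u : P, v : P <- l w) F (x * u) v b1)); last by multilin.
by apply: eq_tlift => w b1; apply: eq_tlift => u v; rewrite mul1r.
Qed.

(** First comes the form with the antipode, h<1>_0 ⊗ h<1>_1 ⊗ h<2> = h_2<1> ⊗ S(h_1) ⊗ h_2<2>; left
    colinearity follows by cancelling h_1 S(h_2). *)
Lemma principal_conn_left : left_colinear_conn l.
Proof.
suff lS (W : lmodType k) (F : P -> H -> P -> W) h : trilinear F ->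
    \tsum_(u : P, v : P <- l h) \tsum_(u0 : P, u1 : H <- coact P u) F u0 u1 v =
    \tsum_(h1 : H, h2 : H <- comul H h) \tsum_(u : P, v : P <- l h2)
      F u (antipode H h1) v.
  move=> W F h Ft; have [F1 F2 F3] := Ft.
  rewrite -(antipoder_sum (K := fun x y => \tsum_(a : P, b : P <- l y) F a x b));
    last by multilin.
  apply: eq_tlift => h1 h2.
  by rewrite (lS _ (fun u g v => F u (h1 * g) v)) //; trilin.
move=> Ft; have [F1 F2 F3] := Ft; have [t [lt tP]] := translation_exists h.
(* [G] is chosen so that G(1, h) is the right side, while its sum over a b_0 ⊗ b_1 contains a factor
   b_1 S(b_2) that cancels. *)
pose G (p : P) (g : H) := \tsum_(p0 : P, p1 : H <- coact P p)
  \tsum_(h1 : H, h2 : H <- comul H g) \tsum_(u : P, v : P <- l h2)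
  F (p0 * u) (p1 * (antipode H h1 : H)) v.
have Gb : bilin G by rewrite /G; multilin.
transitivity (G 1 h); last first.
  rewrite /G (coact_monoid P).1 tliftE; last by multilin.
  by apply: eq_tlift => h1 h2; apply: eq_tlift => u v; rewrite !mul1r.
rewrite {1}lt tlift_tlift; last by multilin.
rewrite -(tP _ G Gb); apply: eq_tlift => a b.
rewrite /sig tlift_tlift; last by multilin.
transitivity (\tsum_(a0 : P, a1 : H <- coact P a) \tsum_(c : coinv P, x : P <- s b)
    F (a0 * coinv_val c) a1 x).
  rewrite -tlift_exchange; apply: eq_tlift => c x.
  rewrite tliftE; last by multilin.
  rewrite coactM_sum; last by multilin.
  apply: eq_tlift => a0 a1; rewrite coinv_val_coact tliftE; last by multilin.
  by rewrite mulr1.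
transitivity (\tsum_(a0 : P, a1 : H <- coact P a) \tsum_(b0 : P, b1 : H <- coact P b)
   \tsum_(u : P, v : P <- l b1) F (a0 * b0 * u) (a1 * 1) v).
  apply: eq_tlift => a0 a1.
  rewrite (@principal_conn_split _ _ (fun u v => F (a0 * u) a1 v)); last by multilin.
  rewrite conn_splitE; last by multilin.
  by apply: eq_tlift => b0 b1; apply: eq_tlift => u v; rewrite mulr1 mulrA.
transitivity (\tsum_(a0 : P, a1 : H <- coact P a) \tsum_(b0 : P, b1 : H <- coact P b)
  \tsum_(y : P, g : H <- coact P b0) \tsum_(h1 : H, h2 : H <- comul H b1)
  \tsum_(u : P, v : P <- l h2) F (a0 * y * u) (a1 * (g * (antipode H h1 : H))) v).
  apply: eq_tlift => a0 a1.
  by rewrite (coact_antipode_sum (K := fun y g z => \tsum_(u : P, v : P <- l z)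
    F (a0 * y * u) (a1 * g) v)) //; trilin.
rewrite tlift_exchange; apply: eq_tlift => b0 b1.
rewrite /G coactM_sum; last by multilin.
apply: eq_tlift => a0 a1; apply: eq_tlift => y g; apply: eq_tlift => h1 h2.
by apply: eq_tlift => u v; rewrite mulrA.
Qed.

End PrincipalConnection.

Lemma principal_strong_connection (k : fieldType) (H : hopfAlgebra k) (P : comodAlgebra H) :
  principal P -> exists l : {linear H -> (P ⊗ P)%type}, strong_connection l.
Proof.
move=> [[K canonK canon_invK] [s [s_colin s_lin s_mul]]].
exists (principal_conn s_lin canonK canon_invK); split; first split.
- exact: principal_conn_right.
- exact: principal_conn_left.
- exact: principal_conn_mul.
Qed.

(** * Averaging against a total integral *)

Section AntipodeComul.
Variables (k : fieldType) (H : hopfAlgebra k).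

(* Convolution argument: comul \o S and flip \o (S ⊗ S) \o comul are a left and
   a right inverse of comul. *)
Lemma comul_antipode (h : H) : comul H (antipode H h) =
  \tsum_(h1 : H, h2 : H <- comul H h) ((antipode H h2 : H) ⊗ (antipode H h1 : H)).
Proof.
pose Y (h : H) : (H ⊗ H)%type :=
  \tsum_(h1 : H, h2 : H <- comul H h) ((antipode H h2 : H) ⊗ (antipode H h1 : H)).
pose X (h : H) : (H ⊗ H)%type := comul H (antipode H h).
have Y_lin : linear Y by rewrite /Y; multilin.
have X_lin : linear X by rewrite /X; multilin.
pose I2 : (H ⊗ H)%type := (1 : H) ⊗ (1 : H).
have XC x : \tsum_(a : H, b : H <- comul H x) (X a * (comul H b : (H ⊗ H)%type)) =
    (counit H x : k) *: I2.
  transitivity (\tsum_(a : H, b : H <- comul H x) comul H ((antipode H a : H) * b)).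
    by apply: eq_tlift => a b; rewrite (comul_monoid H).2.
  by rewrite -linear_tlift antipodel linearZ /= (comul_monoid H).1.
have CY x : \tsum_(a : H, b : H <- comul H x) ((comul H a : (H ⊗ H)%type) * Y b) =
    (counit H x : k) *: I2.
  transitivity (\tsum_(a : H, b : H <- comul H x) \tsum_(a1 : H, a2 : H <- comul H a)
     \tsum_(b1 : H, b2 : H <- comul H b)
     ((a1 * (antipode H b2 : H)) ⊗ (a2 * (antipode H b1 : H)))).
    apply: eq_tlift => a b.
    have ml : linear (fun t : (H ⊗ H)%type => t * Y b) by multilin.
    rewrite -{1}(tlift_tens (comul H a)) (linear_tliftW _ _ ml).
    apply: eq_tlift => a1 a2.
    have mr : linear (fun t : (H ⊗ H)%type => (a1 ⊗ a2) * t) by multilin.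
    rewrite /Y (linear_tliftW _ _ mr); apply: eq_tlift => b1 b2.
    by rewrite tensM.
  rewrite (comulA_sum (F := fun a1 a2 b => \tsum_(b1 : H, b2 : H <- comul H b)
     ((a1 * (antipode H b2 : H)) ⊗ (a2 * (antipode H b1 : H))))); last by trilin.
  transitivity (\tsum_(a1 : H, y : H <- comul H x)
      ((a1 * (antipode H y : H)) ⊗ (1 : H))).
    (* The inner product a_2 S(b_1) cancels first and leaves a_1 S(y). *)
    apply: eq_tlift => a1 y.
    rewrite (antipoder_sum (K := fun u z => (a1 * (antipode H z : H)) ⊗ u)) //.
    by multilin.
  rewrite -(linear_tliftW _ _ ((tens_bilin _ _).1 (1 : H))) antipoder.
  by rewrite tensZl.
rewrite -[LHS]/(X h) -[RHS]/(Y h).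
rewrite -[LHS](counitr_sum (linear_of X_lin)) -[RHS](counitl_sum (linear_of Y_lin)) /=.
(* Both sides equal the triple convolution of [X], [comul] and [Y]. *)
transitivity (\tsum_(a : H, y : H <- comul H h) \tsum_(b : H, c : H <- comul H y)
   (X a * (comul H b : (H ⊗ H)%type) * Y c)).
  apply: eq_tlift => a y.
  have ml : linear (fun t : (H ⊗ H)%type => X a * t) by multilin.
  under [RHS]eq_tlift do rewrite -mulrA.
  by rewrite -(linear_tliftW _ _ ml) CY (linearZW _ _ ml) /I2 tens1 mulr1.
rewrite -(comulA_sum (F := fun a b c => X a * (comul H b : (H ⊗ H)%type) * Y c));
  last by trilin.
apply: eq_tlift => y c.
have ml : linear (fun t : (H ⊗ H)%type => t * Y c) by multilin.
by rewrite -(linear_tliftW _ _ ml) XC (linearZW _ _ ml) /I2 tens1 mul1r.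
Qed.

End AntipodeComul.

Section Averaging.
Variables (k : fieldType) (H : hopfAlgebra k).

Lemma colinear_sum (V P : comodAlgebra H) (W : lmodType k) (f : {linear V -> P})
    (F : P -> H -> W) v : colinear (coact V) (coact P) f -> bilin F ->
  tlift F (coact P (f v)) = \tsum_(v0 : V, v1 : H <- coact V v) F (f v0) v1.
Proof. by move=> fc Fb; rewrite fc (tlift_tmap f idfun). Qed.

(** Right colinearity of [j] when H coacts on itself by [comul], tested on bilinear maps; with j 1 =
    1 this is a total integral. *)
Definition integral (P : comodAlgebra H) (j : H -> P) :=
  forall (W : lmodType k) (F : P -> H -> W) h, bilin F ->
  tlift F (coact P (j h)) = \tsum_(h1 : H, h2 : H <- comul H h) F (j h1) h2.

(** Colinearity comes from that of [l], as [e] has coinvariant values. Since [l 1] is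
    [conn_split l 1], it is left coinvariant, so [e] drops out and j(1) = 1. *)
Lemma total_integral_exists (P : comodAlgebra H) (l : {linear H -> (P ⊗ P)%type}) :
  strong_connection l ->
  exists j : {linear H -> P}, integral j /\ j 1 = 1.
Proof.
move=> lS; have [[lr ll] lm] := lS; have [e [_ eP]] := @coinv_retraction k H P.
pose j0 h : P := \tsum_(a : P, b : P <- l h) (coinv_val (e a) * b).
have jL : linear j0 by rewrite /j0; multilin.
exists (linear_of jL); split.
  move=> W F h Fb; have [F1 F2] := Fb; have FL := tlift_linear Fb.
  have gL : linear (fun x => tlift F (coact P x)) by multilin.
  rewrite /= /j0 (linear_tliftW _ _ gL).
  transitivity (\tsum_(a : P, b : P <- l h) \tsum_(b0 : P, b1 : H <- coact P b)
     F (coinv_val (e a) * b0) b1).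
    apply: eq_tlift => a b; rewrite coactM_sum // coinv_val_coact tliftE; last by multilin.
    by apply: eq_tlift => b0 b1; rewrite mul1r.
  rewrite (lr _ (fun a b0 b1 => F (coinv_val (e a) * b0) b1)); last by trilin.
  by apply: eq_tlift => h1 h2; rewrite -(linear_tliftW _ _ (F1 h2)).
have l1 : conn_split l 1 = l 1.
  rewrite /conn_split (coact_monoid P).1 tliftE; last by multilin.
  rewrite -[RHS]tlift_tens; apply: eq_tlift => a b.
  by rewrite mul1r.
rewrite /= /j0 -l1 (eP _ (fun x y => x * y)); last 2 first.
- by multilin.
- exact: conn_split_coinvariant.
by rewrite conn_split_mul.
Qed.

Section Average.
Variables V P : comodAlgebra H.

Definition average (j : H -> P) (f : V -> P) (v : V) : P :=
  \tsum_(v0 : V, v1 : H <- coact V v) \tsum_(y0 : P, y1 : H <- coact P (f v0))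
    (y0 * j ((antipode H y1 : H) * v1)).

Lemma average_linear (j : {linear H -> P}) (f : {linear V -> P}) : linear (average j f).
Proof. by rewrite /average; multilin. Qed.

(** For colinear [f] the summand is f(v_0) j(S(v_1) v_2), and S(v_1) v_2 collapses to a counit. *)
Lemma average_id (j : {linear H -> P}) (f : {linear V -> P}) :
  colinear (coact V) (coact P) f -> j 1 = 1 -> average j f =1 f.
Proof.
move=> fc j1 v; rewrite /average.
transitivity (\tsum_(v0 : V, v1 : H <- coact V v) \tsum_(u0 : V, u1 : H <- coact V v0)
    (f u0 * j ((antipode H u1 : H) * v1))).
  apply: eq_tlift => v0 v1.
  by rewrite (colinear_sum _ (F := fun y0 y1 => y0 * j ((antipode H y1 : H) * v1)));
    last by multilin.
rewrite (coactA_sum (F := fun u0 u1 v1 => f u0 * j ((antipode H u1 : H) * v1)));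
  last by trilin.
rewrite -[RHS](coact_counit_sum f); apply: eq_tlift => u0 z.
have gL : linear (fun x : H => f u0 * j x) by multilin.
by rewrite -(linear_tliftW _ _ gL) antipodel (linearZW _ _ gL) j1 mulr1.
Qed.

(** As S reverses the comultiplication, the coaction on y_0 j(S(y_1) v_1) is y_0 j(S(y_3) v_1) ⊗ y_1
    S(y_2) v_2; then y_1 S(y_2) cancels and v_2 remains. *)
Lemma average_colinear (j : {linear H -> P}) (f : {linear V -> P}) :
  integral j -> colinear (coact V) (coact P) (average j f).
Proof.
move=> jc v.
rewrite -[LHS]tlift_tens /tmap.
set F := @tens k P H; have Fb : bilin F by exact: tens_bilin.
have [F1 F2] := Fb; have FL := tlift_linear Fb.
have gL : linear (fun x => tlift F (coact P x)) by multilin.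
rewrite {1}/average (linear_tliftW _ _ gL).
transitivity (\tsum_(v0 : V, v1 : H <- coact V v) \tsum_(u0 : P, u1 : H <- coact P (f v0))
   \tsum_(w1 : H, w2 : H <- comul H v1) F (u0 * j ((antipode H u1 : H) * w1)) w2).
  apply: eq_tlift => v0 v1; rewrite (linear_tliftW _ _ gL).
  transitivity (\tsum_(u0 : P, u1 : H <- coact P (f v0)) \tsum_(p0 : P, p1 : H <- coact P u0)
    \tsum_(g1 : H, g2 : H <- comul H u1) \tsum_(w1 : H, w2 : H <- comul H v1)
     F (p0 * j ((antipode H g2 : H) * w1)) (p1 * (antipode H g1 : H) * w2)).
    apply: eq_tlift => y0 y1; rewrite coactM_sum //; apply: eq_tlift => p0 p1.
    rewrite (jc _ (fun q0 q1 => F (p0 * q0) (p1 * q1))); last by multilin.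
    rewrite (comul_monoid H).2 tliftM; last by multilin.
    rewrite comul_antipode tlift_tlift; last by multilin.
    apply: eq_tlift => g1 g2; rewrite tliftE; last by multilin.
    by apply: eq_tlift => w1 w2; rewrite mulrA.
  rewrite (coact_antipode_sum (K := fun p0 x g2 => \tsum_(w1 : H, w2 : H <- comul H v1)
     F (p0 * j ((antipode H g2 : H) * w1)) (x * w2))); last by trilin.
  by apply: eq_tlift => u0 u1; apply: eq_tlift => w1 w2; rewrite mul1r.
transitivity (\tsum_(v0 : V, v1 : H <- coact V v) \tsum_(w1 : H, w2 : H <- comul H v1)
   \tsum_(u0 : P, u1 : H <- coact P (f v0)) F (u0 * j ((antipode H u1 : H) * w1)) w2).
  by apply: eq_tlift => v0 v1; rewrite tlift_exchange.
rewrite -(coactA_sum (F := fun v0 w1 w2 => \tsum_(u0 : P, u1 : H <- coact P (f v0))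
   F (u0 * j ((antipode H u1 : H) * w1)) w2)); last by trilin.
apply: eq_tlift => v0 v1.
rewrite /average (linear_tliftW _ _ (F1 v1)).
by apply: eq_tlift => u0 u1; rewrite (linear_tliftW _ _ (F1 v1)).
Qed.

(** The right side involves [j] only through [pi \o j], so a merely linear lift of an integral of
    [Q] can be used for averaging in [P]. *)
Lemma average_natural (Q : comodAlgebra H) (pi : {linear P -> Q})
    (j : {linear H -> P}) (f : {linear V -> P}) :
  monoid_morphism pi -> colinear (coact P) (coact Q) pi ->
  forall v, pi (average j f v) =
    \tsum_(v0 : V, v1 : H <- coact V v) \tsum_(y0 : Q, y1 : H <- coact Q (pi (f v0)))
      (y0 * pi (j ((antipode H y1 : H) * v1))).
Proof.
move=> pim pic v; rewrite /average linear_tlift; apply: eq_tlift => v0 v1.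
rewrite linear_tlift (colinear_sum _ (F := fun y0 y1 => y0 * pi (j ((antipode H y1 : H) * v1)))) //.
  by apply: eq_tlift => y0 y1; rewrite pim.2.
by multilin.
Qed.

End Average.
End Averaging.

(** * Colinear sections of the surjections *)

Lemma linear_section (k : fieldType) (V W : lmodType k) (f : {linear V -> W}) :
  (forall w, exists v, f v = w) -> exists g : {linear W -> V}, cancel g f.
Proof.
move=> fsurj; have [g gP] := pseudo_inverse_exists f.
by exists g => w; have [v <-] := fsurj w.
Qed.

(** The kernels are treated one at a time: [e] maps V into the first n of them, and [e ⊗ id] fixes
    [t]. For n = N this forces e = 0, hence t = 0. *)
Lemma tmap_joint_injective (k : fieldType) (V X : lmodType k) (N : nat)
    (W : 'I_N -> lmodType k) (f : forall i, {linear V -> W i}) :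
  (forall v, (forall i, f i v = 0) -> v = 0) ->
  forall t : (V ⊗ X)%type, (forall i, tmap (f i) idfun t = 0) -> t = 0.
Proof.
move=> finj t ft.
suff /(_ N (leqnn N))[e [fe te]] : forall n, (n <= N)%N -> exists e : {linear V -> V},
    (forall (i : 'I_N) v, (i < n)%N -> f i (e v) = 0) /\ tmap e idfun t = t.
  rewrite -te /tmap; have -> : (fun (u : V) (v : X) => e u ⊗ idfun v) = (fun u v => 0).
    apply/funext => u; apply/funext => v; rewrite (finj (e u)) ?tens0l // => i.
    exact: fe (ltn_ord i).
  exact: tlift_map0.
elim=> [_|n IH nN].
  by exists idfun; split=> //; exact: tlift_tens.
have [e [fe te]] := IH (ltnW nN).
pose i0 := Ordinal nN.
(* With D = f i0 \o e and D g D = D, the map e - e g D is killed by [f i0]; the correction e g D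
   vanishes on [t] because [f i0 ⊗ id] does. *)
have [g gP] := pseudo_inverse_exists (f i0 \o e).
have e'L : linear (fun v => e v - e (g (f i0 (e v)))) by multilin.
exists (linear_of e'L); split=> [i v|/=].
  rewrite ltnS leq_eqVlt /= linearB => /orP[/eqP i_n|lt_in]; last by rewrite !(fe i) // subrr.
  have -> : i = i0 by exact: val_inj.
  by apply/eqP; rewrite subr_eq0; apply/eqP; exact: esym (gP v).
rewrite /tmap (@tlift_linear_fun _ _ _ _ (-1) (fun u v => e (g (f i0 (e u))) ⊗ v)
  (fun u v => e u ⊗ v)); last first.
  by move=> u v; rewrite -tensPl scaleN1r addrC.
rewrite -[tlift (fun u v => e u ⊗ v) t]/(tmap e idfun t) te.
have Gb : bilin (fun (u : V) (v : X) => e (g (f i0 u)) ⊗ v) by multilin.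
rewrite -(tlift_tmap e idfun t Gb) te.
have Gb' : bilin (fun (u : W i0) (v : X) => e (g u) ⊗ v) by multilin.
by rewrite -(tlift_tmap (f i0) idfun t Gb') ft tlift0 // scaler0 add0r.
Qed.

Section Gluing.
Variables (k : fieldType) (H : hopfAlgebra k) (P : comodAlgebra H).

Lemma integral_lift (Q : comodAlgebra H) (pi : {linear P -> Q}) (j : {linear H -> Q}) :
  comodalg_surjection pi -> j 1 = 1 ->
  exists J : {linear H -> P}, (forall h, pi (J h) = j h) /\ J 1 = 1.
Proof.
move=> [pim _ pis] j1; have [g gK] := linear_section pis.
(* The second term lies in the kernel of [pi], because j 1 = 1, and corrects the value at 1. *)
pose J0 h : P := g (j h) + counit H h *: (1 - g (j 1)).
have J_lin : linear J0 by rewrite /J0; multilin.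
exists (linear_of J_lin); split=> [h|] /=.
  by rewrite linearD linearZ /= linearB !gK j1 pim.1 subrr scaler0 addr0.
by rewrite /J0 (counit_monoid H).1 scale1r addrC subrK.
Qed.

Variables (N : nat) (Q : 'I_N -> comodAlgebra H) (pi : forall i, {linear P -> Q i}).
Hypothesis pi_surj : forall i, comodalg_surjection (pi i).
Hypothesis ker_cap0 : forall p : P, (forall i, pi i p = 0) -> p = 0.

(** The difference of the two sides of the colinearity equation is killed by every [pi i ⊗ id]. *)
Lemma colinear_joint (V : comodAlgebra H) (f : {linear V -> P}) :
  (forall i, colinear (coact V) (coact (Q i)) (pi i \o f)) ->
  colinear (coact V) (coact P) f.
Proof.
move=> fc v; apply/eqP; rewrite -subr_eq0; apply/eqP.
apply: (tmap_joint_injective ker_cap0) => i.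
have [_ pic _] := pi_surj i.
rewrite linearB /= -pic [coact (Q i) _](fc i v) /tmap tlift_tlift; last by multilin.
apply/eqP; rewrite subr_eq0; apply/eqP; apply: eq_tlift => v0 v1.
by rewrite tliftE //; multilin.
Qed.

Hypothesis integrals : forall i, exists j : {linear H -> Q i}, integral j /\ j 1 = 1.

(* Averaging against a lift of the integral of Q_i makes the i-th component
   colinear and does not change the components that are already colinear. *)
Lemma colinear_modification (V : comodAlgebra H) (f : {linear V -> P}) :
  exists g : {linear V -> P}, colinear (coact V) (coact P) g /\
    forall i, colinear (coact V) (coact (Q i)) (pi i \o f) ->
      forall v, pi i (g v) = pi i (f v).
Proof.
suff /(_ N (leqnn N))[g [gc gf]] : forall n, (n <= N)%N -> exists g : {linear V -> P},
    (forall i : 'I_N, (i < n)%N -> colinear (coact V) (coact (Q i)) (pi i \o g)) /\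
    forall i, colinear (coact V) (coact (Q i)) (pi i \o f) ->
      forall v, pi i (g v) = pi i (f v).
  by exists g; split=> //; apply: colinear_joint => i; exact: gc.
elim=> [_|n IH nN]; first by exists f.
have [g [gc gf]] := IH (ltnW nN).
pose i0 := Ordinal nN.
have [j [jint j1]] := integrals i0.
have [J [Jj J1]] := integral_lift (pi_surj i0) j1.
have avgE i : pi i \o average J g = average (pi i \o J) (pi i \o g).
  have [pim pic _] := pi_surj i.
  by apply/funext => v; exact: average_natural.
(* This concerns every index, not only [i0]: [J] is unital in [P], so each [pi i \o J] is unital and
   [average_id] applies. *)
have avg_same i : colinear (coact V) (coact (Q i)) (pi i \o g) ->
    pi i \o average J g = pi i \o g.
  move=> gci; rewrite avgE; apply/funext => v.
  apply: (@average_id _ _ _ _ (pi i \o J) (pi i \o g)) => //=.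
  by have [pim _ _] := pi_surj i; rewrite J1 pim.1.
exists (linear_of (average_linear J g)); split=> [i|i fci v].
  rewrite ltnS leq_eqVlt => /orP[/eqP i_n|lt_in] /=; last first.
    by rewrite avg_same; exact: gc.
  have -> : i = i0 by exact: val_inj.
  rewrite avgE; apply: (@average_colinear _ _ _ _ (pi i0 \o J) (pi i0 \o g)).
  move=> W F h Fb; rewrite /= Jj jint //.
  by apply: eq_tlift => h1 h2; rewrite Jj.
have gci : colinear (coact V) (coact (Q i)) (pi i \o g).
  have -> : (pi i \o g : V -> Q i) = pi i \o f by apply/funext => u; exact: gf fci u.
  exact: fci.
rewrite -(gf i fci v); exact: (congr1 (fun F => F v) (avg_same i gci)).
Qed.

(** The i-th component of a linear section is the identity, which is colinear and hence survives the
    modification. *)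
Lemma colinear_section i : exists g : {linear Q i -> P},
  colinear (coact (Q i)) (coact P) g /\ cancel g (pi i).
Proof.
have [pim pic pis] := pi_surj i; have [s sK] := linear_section pis.
have [g [gc gs]] := colinear_modification s.
exists g; split=> // q; rewrite gs //.
have -> : pi i \o s = id by apply/funext => q'; exact: sK.
by move=> v; rewrite -[LHS]tlift_tens.
Qed.

End Gluing.

(** * Gluing strong connections *)

Section ConnectionOperations.
Variables (k : fieldType) (H : hopfAlgebra k).

Definition conn_image (P Q : comodAlgebra H) (f : {linear P -> Q})
    (l : {linear H -> (P ⊗ P)%type}) : {linear H -> (Q ⊗ Q)%type} := tmap f f \o l.

Lemma conn_imageE (P Q : comodAlgebra H) (f : {linear P -> Q}) l (W : lmodType k)
    (F : Q -> Q -> W) h : bilin F ->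
  tlift F (conn_image f l h) = \tsum_(a : P, b : P <- l h) F (f a) (f b).
Proof. exact: tlift_tmap. Qed.

Lemma conn_image_bicolinear (P Q : comodAlgebra H) (f : {linear P -> Q}) l :
  colinear (coact P) (coact Q) f -> bicolinear l -> bicolinear (conn_image f l).
Proof.
move=> fc [lr ll]; split=> W F h Ft; have [F1 F2 F3] := Ft.
  rewrite conn_imageE; last by multilin.
  transitivity (\tsum_(a : P, b : P <- l h) \tsum_(b0 : P, b1 : H <- coact P b)
    F (f a) (f b0) b1).
    by apply: eq_tlift => a b; rewrite (colinear_sum (F := F (f a))) //; multilin.
  rewrite (lr _ (fun a b0 b1 => F (f a) (f b0) b1)); last by trilin.
  apply: eq_tlift => h1 h2; rewrite (conn_imageE _ _ (F := fun a b => F a b h2)) //.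
rewrite (conn_imageE _ _ (F := fun a b => F a 1 b)); last by multilin.
rewrite -(ll _ (fun a0 a1 b => F (f a0) a1 (f b))); last by trilin.
apply: eq_tlift => h1 h2; rewrite conn_imageE; last by multilin.
apply: eq_tlift => a b.
by rewrite (colinear_sum (F := fun a0 a1 => F a0 (h1 * a1) (f b))) //; multilin.
Qed.

Lemma conn_mul_image (P Q : comodAlgebra H) (f : {linear P -> Q}) l h :
  monoid_morphism f -> conn_mul (conn_image f l) h = f (conn_mul l h).
Proof.
move=> fm; rewrite /conn_mul conn_imageE; last by multilin.
by rewrite linear_tlift; apply: eq_tlift => a b; rewrite fm.2.
Qed.

Lemma strong_connection_image (P Q : comodAlgebra H) (f : {linear P -> Q}) l :
  monoid_morphism f -> colinear (coact P) (coact Q) f ->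
  strong_connection l -> strong_connection (conn_image f l).
Proof.
move=> fm fc [lb lm]; split; first exact: conn_image_bicolinear.
by move=> h; rewrite conn_mul_image // lm linearZ /= fm.1.
Qed.

Variable P : comodAlgebra H.
Implicit Types l : {linear H -> (P ⊗ P)%type}.

(* For right colinear l: zero iff the canonical map sends l h to 1 ⊗ h for all h. *)
Definition conn_defect l (h : H) : P := counit H h *: (1 : P) - conn_mul l h.

Lemma conn_mul_linear l : linear (conn_mul l).
Proof. by rewrite /conn_mul; multilin. Qed.

Lemma conn_defect_linear l : linear (conn_defect l).
Proof.
rewrite /conn_defect; apply: linear_addf; first by multilin.
exact/linear_oppf/conn_mul_linear.
Qed.

(** This is colinearity of h |-> h<1> h<2> for the adjoint coaction h |-> h_2 ⊗ S(h_1) h_3, written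
    without the antipode. The two colinearities of [l] treat one leg each. *)
Lemma conn_mul_adjoint l (W : lmodType k) (G : P -> H -> W) h :
  bicolinear l -> bilin G ->
  \tsum_(h1 : H, h2 : H <- comul H h) \tsum_(c0 : P, c1 : H <- coact P (conn_mul l h2))
    G c0 (h1 * c1) =
  \tsum_(h1 : H, h2 : H <- comul H h) G (conn_mul l h1) h2.
Proof.
move=> [lr ll] Gb; have [G1 G2] := Gb.
transitivity (\tsum_(h1 : H, h2 : H <- comul H h) \tsum_(a : P, b : P <- l h2)
  \tsum_(a0 : P, a1 : H <- coact P a) \tsum_(b0 : P, b1 : H <- coact P b)
    G (a0 * b0) (h1 * a1 * b1)).
  apply: eq_tlift => h1 h2.
  have cL : linear (fun x => \tsum_(c0 : P, c1 : H <- coact P x) G c0 (h1 * c1)) by multilin.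
  rewrite /conn_mul (linear_tliftW _ _ cL); apply: eq_tlift => a b.
  rewrite (coactM_sum (F := fun c0 c1 => G c0 (h1 * c1))); last by multilin.
  by apply: eq_tlift => a0 a1; apply: eq_tlift => b0 b1; rewrite mulrA.
rewrite (ll _ (fun a0 y b => \tsum_(b0 : P, b1 : H <- coact P b) G (a0 * b0) (y * b1)));
  last by trilin.
rewrite (lr _ (fun a b0 b1 => G (a * b0) (1 * b1))); last by trilin.
apply: eq_tlift => h1 h2; rewrite /conn_mul (linear_tliftW _ _ (G1 h2)).
by apply: eq_tlift => a b; rewrite mul1r.
Qed.

(** The map h |-> counit h 1 is colinear in the same sense, so the defect inherits the property from
    [conn_mul l]. *)
Lemma conn_defect_adjoint l (W : lmodType k) (G : P -> H -> W) h :
  bicolinear l -> bilin G ->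
  \tsum_(h1 : H, h2 : H <- comul H h) \tsum_(c0 : P, c1 : H <- coact P (conn_defect l h2))
    G c0 (h1 * c1) =
  \tsum_(h1 : H, h2 : H <- comul H h) G (conn_defect l h1) h2.
Proof.
move=> lb Gb; have [G1 G2] := Gb.
have mL := conn_mul_linear l.
transitivity (-1 *: (\tsum_(h1 : H, h2 : H <- comul H h) G (conn_mul l h1) h2) + G 1 h).
  rewrite -(conn_mul_adjoint h lb Gb) -[G 1 h](counitr_sum (linear_of (G2 1))).
  apply: tlift_linear_fun => h1 h2.
  have cL : linear (fun x => \tsum_(c0 : P, c1 : H <- coact P x) G c0 (h1 * c1)) by multilin.
  rewrite /conn_defect addrC -scaleN1r cL (linearZW _ _ cL); congr (_ + _ *: _).
  by rewrite (coact_monoid P).1 tliftE ?mulr1 //; multilin.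
rewrite -[G 1 h](counitl_sum (linear_of (G2 1))); apply/esym/tlift_linear_fun => h1 h2.
by rewrite /conn_defect addrC -scaleN1r G1 (linearZW _ _ (G1 h2)).
Qed.

Lemma bicolinear0 : bicolinear (\0 : {linear H -> (P ⊗ P)%type}).
Proof.
split=> W F h Ft; have [F1 F2 F3] := Ft.
  rewrite [LHS]tlift0; last by multilin.
  rewrite -[LHS](tlift_map0 _ (comul H h)); apply: eq_tlift => h1 h2.
  by rewrite [RHS]tlift0; last by multilin.
rewrite [RHS]tlift0; last by multilin.
rewrite -[RHS](tlift_map0 _ (comul H h)); apply: eq_tlift => h1 h2.
by rewrite [LHS]tlift0; last by multilin.
Qed.

Definition conn_glue_fun l1 l2 (h : H) : (P ⊗ P)%type :=
  l1 h + \tsum_(h1 : H, h2 : H <- comul H h) \tsum_(a : P, b : P <- l2 h2)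
    ((conn_defect l1 h1 * a) ⊗ b).

Lemma conn_glue_linear l1 l2 : linear (conn_glue_fun l1 l2).
Proof. by have dL := conn_defect_linear l1; rewrite /conn_glue_fun; multilin. Qed.

Definition conn_glue l1 l2 := linear_of (conn_glue_linear l1 l2).

Lemma conn_glueE l1 l2 (W : lmodType k) (F : P -> P -> W) h : bilin F ->
  tlift F (conn_glue l1 l2 h) = tlift F (l1 h) +
  \tsum_(h1 : H, h2 : H <- comul H h) \tsum_(a : P, b : P <- l2 h2)
    F (conn_defect l1 h1 * a) b.
Proof.
move=> Fb; rewrite /= /conn_glue_fun tliftD //; congr (_ + _).
rewrite tlift_tlift //; apply: eq_tlift => h1 h2; rewrite tlift_tlift //.
by apply: eq_tlift => a b; rewrite tliftE.
Qed.

(** On the right, the defect touches first legs only, and coassociativity suffices. On the left,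
    [conn_defect_adjoint] absorbs the coaction on the defect, and left colinearity of [l2]
    finishes. *)
Lemma conn_glue_bicolinear l1 l2 :
  bicolinear l1 -> bicolinear l2 -> bicolinear (conn_glue l1 l2).
Proof.
move=> l1b [r2 ll2]; have [r1 ll1] := l1b; have dL := conn_defect_linear l1.
set d := conn_defect l1 in dL.
split=> W F h Ft; have [F1 F2 F3] := Ft.
  rewrite conn_glueE; last by multilin.
  rewrite r1 //.
  transitivity (\tsum_(h1 : H, h2 : H <- comul H h) (\tsum_(a : P, b : P <- l1 h1) F a b h2
    + \tsum_(g1 : H, g2 : H <- comul H h1) \tsum_(a : P, b : P <- l2 g2) F (d g1 * a) b h2));
    last first.
    apply: eq_tlift => h1 h2.
    by rewrite (conn_glueE _ _ _ (F := fun a b => F a b h2)) //; multilin.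
  rewrite tlift_mapD; congr (_ + _).
  rewrite (comulA_sum (F := fun g1 g2 h2 => \tsum_(a : P, b : P <- l2 g2) F (d g1 * a) b h2));
    last by trilin.
  apply: eq_tlift => h1 h2.
  by rewrite (r2 _ (fun a b0 b1 => F (d h1 * a) b0 b1)) //; trilin.
rewrite (conn_glueE _ _ _ (F := fun a b => F a 1 b)); last by multilin.
rewrite -ll1 //.
transitivity (\tsum_(h1 : H, h2 : H <- comul H h)
  (\tsum_(a : P, b : P <- l1 h2) \tsum_(a0 : P, a1 : H <- coact P a) F a0 (h1 * a1) b +
   \tsum_(g1 : H, g2 : H <- comul H h2) \tsum_(c0 : P, c1 : H <- coact P (d g1))
     \tsum_(a : P, b : P <- l2 g2) \tsum_(a0 : P, a1 : H <- coact P a)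
       F (c0 * a0) (h1 * c1 * a1) b)).
  apply: eq_tlift => h1 h2; rewrite conn_glueE; last by multilin.
  congr (_ + _); apply: eq_tlift => g1 g2; rewrite -tlift_exchange; apply: eq_tlift => a b.
  rewrite coactM_sum; last by multilin.
  by apply: eq_tlift => c0 c1; apply: eq_tlift => a0 a1; rewrite mulrA.
rewrite tlift_mapD; congr (_ + _).
rewrite -(comulA_sum (F := fun h1 g1 g2 => \tsum_(c0 : P, c1 : H <- coact P (d g1))
  \tsum_(a : P, b : P <- l2 g2) \tsum_(a0 : P, a1 : H <- coact P a)
  F (c0 * a0) (h1 * c1 * a1) b)); last by trilin.
transitivity (\tsum_(x : H, g2 : H <- comul H h) \tsum_(y1 : H, y2 : H <- comul H x)
   \tsum_(a : P, b : P <- l2 g2) \tsum_(a0 : P, a1 : H <- coact P a)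
    F (d y1 * a0) (y2 * a1) b).
  apply: eq_tlift => x g2.
  by rewrite (conn_defect_adjoint (G := fun c0 y => \tsum_(a : P, b : P <- l2 g2)
    \tsum_(a0 : P, a1 : H <- coact P a) F (c0 * a0) (y * a1) b)) //; multilin.
rewrite (comulA_sum (F := fun y1 y2 g2 => \tsum_(a : P, b : P <- l2 g2)
    \tsum_(a0 : P, a1 : H <- coact P a) F (d y1 * a0) (y2 * a1) b)); last by trilin.
apply: eq_tlift => y1 z.
by rewrite (ll2 _ (fun a0 y b => F (d y1 * a0) y b)) //; trilin.
Qed.

(** With c1 the defect of [l1] and the counit as convolution unit, the new defect is c1 minus the
    convolution of c1 with [conn_mul l2], and c1 factors out. *)
Lemma conn_glue_defect l1 l2 h : conn_defect (conn_glue l1 l2) h =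
  \tsum_(h1 : H, h2 : H <- comul H h) (conn_defect l1 h1 * conn_defect l2 h2).
Proof.
have dL := conn_defect_linear l1.
rewrite {1}/conn_defect /conn_mul conn_glueE; last by multilin.
rewrite opprD addrA -/(conn_mul l1 h) -/(conn_defect l1 h).
rewrite -[conn_defect l1 h](counitr_sum (linear_of dL)) -scaleN1r addrC.
apply/esym/tlift_linear_fun => h1 h2 /=.
rewrite {2}/conn_defect mulrDr mulrN -algscalerAr mulr1 scaleN1r addrC; congr (- _ + _).
rewrite /conn_mul (linear_tliftW _ _ (algmull_linear _)).
by apply: eq_tlift => a b; rewrite mulrA.
Qed.

End ConnectionOperations.

Theorem theorem3p3 (k : fieldType) (H : hopfAlgebra k)
    (antipode_bij : bijective (antipode H))
    (N : nat) (N_gt0 : (0 < N)%N)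
    (P : comodAlgebra H) (Q : 'I_N -> comodAlgebra H)
    (pi : forall i : 'I_N, {linear P -> Q i})
    (pi_surj : forall i : 'I_N, comodalg_surjection (pi i))
    (ker_cap0 : forall p : P, (forall i : 'I_N, pi i p = 0) -> p = 0) :
  principal P <-> (forall i : 'I_N, principal (Q i)).
Proof.
split=> [/principal_strong_connection[l lS] i|Qprin].
  have [pim pic _] := pi_surj i.
  exact: strong_connection_principal (strong_connection_image pim pic lS).
have integrals i : exists j : {linear H -> Q i}, integral j /\ j 1 = 1.
  have [l lS] := principal_strong_connection (Qprin i).
  exact: total_integral_exists lS.
(* After n steps the defect lies in the first n kernels; for n = N it vanishes by [ker_cap0], and
   [l] is a strong connection. *)
suff /(_ N (leqnn N))[l [lb ld]] : forall n, (n <= N)%N ->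
    exists l : {linear H -> (P ⊗ P)%type}, bicolinear l /\
    forall i : 'I_N, (i < n)%N -> forall h, pi i (conn_defect l h) = 0.
  apply: (@strong_connection_principal _ _ _ l); split=> // h; apply/eqP.
  rewrite eq_sym -subr_eq0; apply/eqP/ker_cap0 => i; exact: ld (ltn_ord i) h.
elim=> [_|n IH nN].
  by exists \0; split=> //; exact: bicolinear0.
have [l [lb ld]] := IH (ltnW nN); pose i0 := Ordinal nN.
have [l0 [l0b l0m]] := principal_strong_connection (Qprin i0).
have [s [sc sK]] := colinear_section pi_surj ker_cap0 integrals i0.
exists (conn_glue l (conn_image s l0)); split.
  by apply: conn_glue_bicolinear => //; exact: conn_image_bicolinear.
move=> i i_n h; have [pim _ _] := pi_surj i.
rewrite conn_glue_defect linear_tlift -[RHS](tlift_map0 _ (comul H h)).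
apply: eq_tlift => h1 h2; rewrite pim.2.
(* Of the two factors, [pi i] kills the first for i < n by induction, and the second for i = n. *)
move: i_n; rewrite ltnS leq_eqVlt => /orP[/eqP i_n|lt_in]; last by rewrite ld // mul0r.
have -> : i = i0 by exact: val_inj.
have [pim0 _ _] := pi_surj i0.
suff -> : pi i0 (conn_defect (conn_image s l0) h2) = 0 by rewrite mulr0.
(* As [s] is a section, [pi i0] turns the product of the legs of the lifted connection into that of
   [l0], which is the counit. *)
rewrite linearB linearZ /= pim0.1 /conn_mul conn_imageE; last by multilin.
rewrite linear_tlift -(l0m h2); apply/eqP; rewrite subr_eq0; apply/eqP.
by apply: eq_tlift => a b; rewrite pim0.2 !sK.
Qed.
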